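(* Let $I_0=[t_0,t_0+L]$ ($L>0$), $r\ge 0$, $I_-=[t_0-r,t_0]$, $I=I_-\cup I_0$, and let $k\in\mathcal{C}(I_-)$. Assume that $f:\mathbb{R}\to\mathbb{R}$ is a continuous function satisfying $$\lim_{y\to+\infty}f(y)=+\infty,\qquad \lim_{y\to-\infty}f(y)=-\infty,\qquad \lim_{y\to\pm\infty}\frac{f(y)}{y}<\frac1L$$ (the last condition meaning that the limits at $+\infty$ and at $-\infty$ are both less than $1/L$). Put $\varphi_*=\min_{t\in I_-}k(t)$ and $\varphi^*=\max_{t\in I_-}k(t)$. Then there exist $m,\overline{m}>0$ such that, for every Carathéodory function $\tau:I_0\times\mathcal{C}(I)\to I$, the functions $$\alpha(t)=\begin{cases}\varphi_*, & t<t_0,\\ m(t_0-t)+\varphi_*, & t\ge t_0,\end{cases}\qquad \beta(t)=\begin{cases}\varphi^*, & t<t_0,\\ \overline{m}(t-t_0)+\varphi^*, & t\ge t_0,\end{cases}\qquad (t\in I)$$ are, respectively, a lower and an upper solution (in the sense defined in the context) for the problem $$(P)\qquad x'(t)=f(x(\tau(t,x)))\ \text{ for a.a. }t\in I_0,\qquad x(t)=k(t)\ \text{ for all }t\in I_-.$$ In particular, for every such $\tau$, problem $(P)$ has maximal and minimal solutions between $\alpha$ and $\beta$, i.e. in $[\alpha,\beta]=\{\gamma\in\mathcal{C}(I):\alpha\le\gamma\le\beta\text{ on }I\}$.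
   Context: $\mathcal{C}(J)$ is the set of real continuous functions on the interval $J$; $AC(I_0)$ is the set of absolutely continuous functions on $I_0$; ''a.a.'' means almost all (Lebesgue measure). $\tau:I_0\times\mathcal{C}(I)\to I$ is Carathéodory if $\tau(\cdot,\gamma)$ is measurable for each $\gamma\in\mathcal{C}(I)$ and, for a.a. $t\in I_0$, $\tau(t,\cdot)$ is continuous on $\mathcal{C}(I)$ with the topology of uniform convergence. A solution of $(P)$ is a function $x\in\mathcal{C}(I)$ such that $x_{|I_0}\in AC(I_0)$ and $x$ satisfies both relations in $(P)$. Order: for $\gamma_1,\gamma_2\in\mathcal{C}(I)$, $\gamma_1\le\gamma_2$ iff $\gamma_1(t)\le\gamma_2(t)$ for all $t\in I$. For $Y\subset\mathcal{C}(I)$, a solution $x_*\in Y$ is a minimal (respectively, maximal) solution in $Y$ if, whenever $x\in Y$ is a solution with $x\le x_*$ (respectively, $x\ge x_*$), then $x=x_*$. Lower and upper solutions: for $t\in I_0$ put $\tau_*(t)=\inf_{\gamma\in\mathcal{C}(I)}\tau(t,\gamma)$ and $\tau^*(t)=\sup_{\gamma\in\mathcal{C}(I)}\tau(t,\gamma)$. Functions $\alpha,\beta\in\mathcal{C}(I)$ with $\alpha\le\beta$ on $I$ are a lower and an upper solution for $(P)$ if $\alpha_{|I_0},\beta_{|I_0}\in AC(I_0)$ and $$\alpha'(t)\le\min_{\xi\in E(t)}f(\xi)\ \text{ for a.a. }t\in I_0,\qquad \alpha\le k\ \text{ on }I_-,$$ $$\beta'(t)\ge\max_{\xi\in E(t)}f(\xi)\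 \text{ for a.a. }t\in I_0,\qquad \beta\ge k\ \text{ on }I_-,$$ where $$E(t)=\Big[\min_{s\in[\tau_*(t),\tau^*(t)]}\alpha(s),\ \max_{s\in[\tau_*(t),\tau^*(t)]}\beta(s)\Big]\quad(t\in I_0).$$ *)

(* Defs.v *)
From HB Require Import structures.
From mathcomp Require Import all_boot all_order all_algebra.
From mathcomp Require Import all_classical all_reals all_analysis.
From mathcomp Require Import measurable_realfun.
Set Implicit Arguments.
Unset Strict Implicit.
Unset Printing Implicit Defensive.
Import Order.TTheory GRing.Theory Num.Theory.
Import numFieldNormedType.Exports.
Local Open Scope classical_set_scope.
Local Open Scope ring_scope.

(* The default value 0 is only taken when the minimum (maximum) does not exist.
   Everywhere below the set is the image of a nonempty compact interval under a
   continuous function, so that it does exist. *)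
Definition set_min (R : realType) (A : set R) : R :=
  xget 0 [set m | A m /\ lbound A m].
Definition set_max (R : realType) (A : set R) : R :=
  xget 0 [set m | A m /\ ubound A m].

Definition I_zero (R : realType) (t0 L : R) : set R := `[t0, t0 + L].
Definition I_minus (R : realType) (t0 r : R) : set R := `[t0 - r, t0].
Definition I_all (R : realType) (t0 L r : R) : set R :=
  I_minus t0 r `|` I_zero t0 L.

(* Functions on J are represented by total functions R -> R whose values
   outside J are irrelevant: two of them denote the same element of C(J) when
   they agree on J. *)
Definition contC (R : realType) (J : set R) : set (R -> R) :=
  [set x : R -> R | {within J, continuous x}].
Definition eq_on (R : realType) (J : set R) (x y : R -> R) : Prop :=
  forall t, J t -> x t = y t.
Definition le_on (R : realType) (J : set R) (x y : R -> R) : Prop :=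
  forall t, J t -> x t <= y t.

Definition abs_cont_on (R : realType) (J : set R) (x : R -> R) : Prop :=
  forall e : R, 0 < e -> exists2 d : R, 0 < d &
  forall (n : nat) (a b : 'I_n -> R),
    (forall i, [/\ J (a i), J (b i) & a i <= b i]) ->
    trivIset [set: 'I_n] (fun i => `]a i, b i[%classic) ->
    \sum_(i < n) (b i - a i) < d ->
    \sum_(i < n) `|x (b i) - x (a i)| < e.

(* The canonical sigma-algebra on R is Borel; measurability in the sense of
   Lebesgue refers to its completion. *)
Definition lebesgue_measurable_fun (R : realType) (D : set R) (g : R -> R) :
    Prop :=
  @measurable_fun _ _
    (g_sigma_algebraType (completed_algebra_gen (@lebesgue_measure R)))
    (measurableTypeR R) D g.

(* The argument types select the topology of uniform convergence on J. *)
Definition unif_top_continuous (R : realType) (J : set R)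
    (S : set {uniform` J -> R}) (phi : {uniform` J -> R} -> R) : Prop :=
  {within S, continuous phi}.

(* The third field says that tau(t, .) is well defined on C(I), see contC. *)
Record caratheodory (R : realType) (t0 L r : R) (tau : R -> (R -> R) -> R) :
    Prop := Caratheodory {
  car_range : forall t g, I_zero t0 L t -> contC (I_all t0 L r) g ->
    I_all t0 L r (tau t g);
  car_meas : forall g, contC (I_all t0 L r) g ->
    lebesgue_measurable_fun (I_zero t0 L) (tau ^~ g);
  car_ext : forall t g1 g2, I_zero t0 L t ->
    contC (I_all t0 L r) g1 -> contC (I_all t0 L r) g2 ->
    eq_on (I_all t0 L r) g1 g2 -> tau t g1 = tau t g2;
  car_cont : {ae @lebesgue_measure R, forall t, I_zero t0 L t ->
    @unif_top_continuous R (I_all t0 L r) (contC (I_all t0 L r)) (tau t)}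
}.

Definition tau_inf (R : realType) (t0 L r : R) (tau : R -> (R -> R) -> R)
    (t : R) : R :=
  inf [set tau t g | g in contC (I_all t0 L r)].
Definition tau_sup (R : realType) (t0 L r : R) (tau : R -> (R -> R) -> R)
    (t : R) : R :=
  sup [set tau t g | g in contC (I_all t0 L r)].

Definition E_set (R : realType) (t0 L r : R) (tau : R -> (R -> R) -> R)
    (alpha beta : R -> R) (t : R) : set R :=
  let J := `[tau_inf t0 L r tau t, tau_sup t0 L r tau t]%classic in
  `[set_min (alpha @` J), set_max (beta @` J)].

Record lower_upper_solution (R : realType) (t0 L r : R) (k f : R -> R)
    (tau : R -> (R -> R) -> R) (alpha beta : R -> R) : Prop :=
  LowerUpperSolution {
  lus_lower_cont : contC (I_all t0 L r) alpha;
  lus_upper_cont : contC (I_all t0 L r) beta;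
  lus_le : le_on (I_all t0 L r) alpha beta;
  lus_lower_ac : abs_cont_on (I_zero t0 L) alpha;
  lus_upper_ac : abs_cont_on (I_zero t0 L) beta;
  lus_lower_deriv : {ae @lebesgue_measure R, forall t, I_zero t0 L t ->
    derivable alpha t 1 /\
    derive1 alpha t <= set_min (f @` E_set t0 L r tau alpha beta t)};
  lus_lower_init : le_on (I_minus t0 r) alpha k;
  lus_upper_deriv : {ae @lebesgue_measure R, forall t, I_zero t0 L t ->
    derivable beta t 1 /\
    set_max (f @` E_set t0 L r tau alpha beta t) <= derive1 beta t};
  lus_upper_init : le_on (I_minus t0 r) k beta
}.

Record solution (R : realType) (t0 L r : R) (k f : R -> R)
    (tau : R -> (R -> R) -> R) (x : R -> R) : Prop := Solution {
  sol_cont : contC (I_all t0 L r) x;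
  sol_ac : abs_cont_on (I_zero t0 L) x;
  sol_deriv : {ae @lebesgue_measure R, forall t, I_zero t0 L t ->
    derivable x t 1 /\ derive1 x t = f (x (tau t x))};
  sol_init : eq_on (I_minus t0 r) x k
}.

Definition fun_interval (R : realType) (J : set R) (alpha beta : R -> R) :
    set (R -> R) :=
  [set g | [/\ contC J g, le_on J alpha g & le_on J g beta]].

Definition minimal_solution (R : realType) (t0 L r : R) (k f : R -> R)
    (tau : R -> (R -> R) -> R) (Y : set (R -> R)) (xm : R -> R) : Prop :=
  [/\ Y xm, solution t0 L r k f tau xm &
    forall x, Y x -> solution t0 L r k f tau x ->
      le_on (I_all t0 L r) x xm -> eq_on (I_all t0 L r) x xm].
Definition maximal_solution (R : realType) (t0 L r : R) (k f : R -> R)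
    (tau : R -> (R -> R) -> R) (Y : set (R -> R)) (xM : R -> R) : Prop :=
  [/\ Y xM, solution t0 L r k f tau xM &
    forall x, Y x -> solution t0 L r k f tau x ->
      le_on (I_all t0 L r) xM x -> eq_on (I_all t0 L r) x xM].

Definition lower_fun (R : realType) (t0 r : R) (k : R -> R) (m : R) : R -> R :=
  fun t => if t < t0 then set_min (k @` I_minus t0 r)
           else m * (t0 - t) + set_min (k @` I_minus t0 r).
Definition upper_fun (R : realType) (t0 r : R) (k : R -> R) (m : R) : R -> R :=
  fun t => if t < t0 then set_max (k @` I_minus t0 r)
           else m * (t - t0) + set_max (k @` I_minus t0 r).

(* Main.v *)
Require Import Defs.
From HB Require Import structures.
From mathcomp Require Import all_boot all_order all_algebra.
From mathcomp Require Import zify ring lra.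

(** The constants. Let [v = phi^*] and choose [c] with [0 <= c < 1 / L] such
    that [f y <= c * y] for large [y]. Since [f] tends to [-oo] at [-oo], it
    is bounded above by some [M] on the rest of the line, so that [f <=
    mbar] on [(-oo, v + mbar * L]] as soon as [mbar] exceeds both [M] and [c
    * (v + mbar * L)], which is possible because [c * L < 1]
    ([sublinear_bound]). This bound does not involve [m]; reflecting [f]
    through the origin gives the analogous [m]. Since [E(t)] lies in [[phi_*
    - m L, phi^* + mbar L]] for every [tau], [alpha] and [beta] are a lower
    and an upper solution for all [tau] at once.

    Existence. For [x] between [alpha] and [beta] the right-hand side [f (x
    (tau t x))] lies in [[- m, mbar]]. Hence the Picard operator, which
    integrates it from [t0] on, maps [[alpha, beta]] into the set [K] of
    continuations of [k] with slopes in [[- m, mbar]], and [K] is contained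
    in [[alpha, beta]]. The set [K] is compact for uniform convergence
    ([slope_class_compact]) and the Picard operator is sequentially
    continuous there by dominated convergence, so that Schauder's theorem
    applies. As [tau] may depend on the whole function, Brouwer's theorem
    enters in every dimension. It suffices to have approximate fixed points
    of maps of the cube, because compactness of [K] turns approximate fixed
    points into exact ones ([exists_fixpoint]). Functions that are affine on
    [n] equal pieces of [[t0, t0 + L]] are parametrized by their slopes,
    that is by a cube, and matching the slopes with the mean values of the
    right-hand side is a finite-dimensional fixed-point problem
    ([approx_fixpoint]).

    Approximate fixed points on a cube come from a combinatorial lemma in
    the style of Scarf, of Petri and Voorneveld ([colourful_dominant_set]):
    points of a grid are ranked by each coordinate and by the negated sum of
    the coordinates, and coloured by a coordinate that the map does not
    decrease. A set of grid points that shows all relevant colours and that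
    no grid point beats in all relevant rankings has small diameter and
    locates an approximate fixed point.

    Extremal solutions. A fixed point of the Picard operator is a solution,
    and a solution in [[alpha, beta]] agrees on the whole interval with a
    fixed point, because an absolutely continuous function with zero
    derivative almost everywhere is constant ([abs_cont_zero_derivative]).
    The fixed points form a compact set, every chain of them therefore has
    upper and lower bounds, and Zorn's lemma yields maximal and minimal
    ones. *)

Set Implicit Arguments.
Unset Strict Implicit.
Unset Printing Implicit Defensive.
Import Order.TTheory GRing.Theory Num.Theory.

(** * A combinatorial lemma of Scarf type *)

Section Scarf.
Local Open Scope nat_scope.
Variables (I X : finType) (w : I -> X -> nat).
Hypothesis w_inj : forall i, injective (w i).
Variables (x0 : X) (i0 : I) (c : X -> I).

(** Every index [i] gets a slack element [inr i].  It turns the pairs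
    (set of points, set of active indices) of the lemma into plain sets whose
    size can be compared with that of [I]: the active indices of [B] are those
    whose slack element is not in [B]. *)
Definition good : Type := (X + I)%type.
HB.instance Definition _ := Finite.on good.

Definition wmax : nat := \max_(p : I * X) w p.1 p.2.

(** For index [i] its own slack element ranks below every point, and the other
    slack elements rank above every point. *)
Definition rank (i : I) (g : good) : nat :=
  match g with
  | inl x => (w i x).+1
  | inr j => if j == i then 0 else (wmax + enum_rank j).+2
  end.

Definition gcolor (g : good) : I :=
  match g with inl x => c x | inr j => j end.

(** No element is better than all members of [B] for every index at once. *)
Definition dominant (B : {set good}) : bool :=
  [forall y, [exists i, [forall b in B, rank i y <= rank i b]]].

Lemma w_le_wmax i x : w i x <= wmax.
Proof. exact: (leq_bigmax (i, x)). Qed.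

Lemma rank_inj i : injective (rank i).
Proof.
move=> [x|j] [y|k] //=.
- by move=> [] /w_inj ->.
- case: eqP => // _ [] E.
  by have := w_le_wmax i x; rewrite E ltnNge leq_addr.
- case: eqP => // _ [] E.
  by have := w_le_wmax i y; rewrite -E ltnNge leq_addr.
- case: eqP => [->|_]; case: eqP => [->|_] //.
  by move=> [] /addnI/val_inj/enum_rank_inj ->.
Qed.

Lemma rank_slack_gt i j x : j != i -> rank i (inl x) < rank i (inr j).
Proof.
by move=> /negbTE /= ->; rewrite !ltnS (leq_trans (w_le_wmax i x)) ?leq_addr.
Qed.

Lemma rank_slack0 i : rank i (inr i) = 0.
Proof. by rewrite /= eqxx. Qed.

Lemma dominantP (B : {set good}) :
  reflect (forall y, exists i, forall b, b \in B -> rank i y <= rank i b)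
          (dominant B).
Proof.
apply: (iffP forallP) => H y; have := H y.
- by case/existsP => i /forall_inP h; exists i.
- by case=> i h; apply/existsP; exists i; apply/forall_inP.
Qed.

Definition worst (B : {set good}) (g0 : good) (i : I) : good :=
  [arg min_(b < g0 in B) rank i b].

Lemma worst_in (B : {set good}) g0 i : g0 \in B -> worst B g0 i \in B.
Proof. by move=> h; rewrite /worst; case: arg_minnP. Qed.

Lemma worst_le (B : {set good}) g0 i b : g0 \in B -> b \in B ->
  rank i (worst B g0 i) <= rank i b.
Proof. by move=> h; rewrite /worst; case: arg_minnP => // z _; exact. Qed.

Lemma worstE (B : {set good}) g0 i b : b \in B -> g0 \in B ->
  (forall b', b' \in B -> rank i b <= rank i b') -> worst B g0 i = b.
Proof.
move=> bB gB h; apply: (@rank_inj i); apply/eqP.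
by rewrite eqn_leq worst_le //= h // worst_in.
Qed.

(** Dominance applied to [b] itself gives an index for which [b] is worst.
    Hence a dominant set has at most as many members as there are indices. *)
Lemma worst_onto (B : {set good}) g0 : g0 \in B -> dominant B -> worst B g0 @: setT = B.
Proof.
move=> gB /dominantP dB; apply/eqP; rewrite eqEsubset; apply/andP; split.
  by apply/subsetP => _ /imsetP[i _ ->]; exact: worst_in.
apply/subsetP => b bB; have [i hi] := dB b.
by apply/imsetP; exists i => //; rewrite (worstE bB).
Qed.

(** Cells and doors play the parts of the simplices and the doors in the proof
    of Sperner's lemma. *)
Definition door (B : {set good}) : bool :=
  dominant B && (gcolor @: B == ~: [set i0]) && (#|B| == #|I|.-1).

Definition cell (B : {set good}) : bool := dominant B && (#|B| == #|I|).

Lemma dominantS (A B : {set good}) : A \subset B -> dominant B -> dominant A.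
Proof.
move=> /subsetP AB /dominantP dB; apply/dominantP => y.
by have [i hi] := dB y; exists i => b /AB /hi.
Qed.

(** If all colours occur in [B], they occur once each, and only the member of
    colour [i0] can be omitted.  Otherwise, as soon as omitting some [b] leaves
    all colours but [i0], the colour of [b] occurs once more in [B], and the two
    members of that colour are the only ones that can be omitted. *)
Lemma odd_doors_of_cell (B : {set good}) : #|B| = #|I| ->
  odd #|[set b in B | gcolor @: (B :\ b) == ~: [set i0]]|
    = (gcolor @: B == setT).
Proof.
move=> cardB.
set D := [set b in B | _].
case: (altP (gcolor @: B =P setT)) => [full|nfull].
  have inj : {in B &, injective gcolor}.
    by apply/imset_injP; rewrite full cardsT cardB.
  have /imsetP[b bB bi0] : i0 \in gcolor @: B by rewrite full.
  suff -> : D = [set b] by rewrite cards1.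
  apply/setP => z; rewrite !inE; apply/andP/eqP => [[zB /eqP Ez]|->].
    apply/eqP/negPn/negP => nzb.
    have : i0 \in gcolor @: (B :\ z).
      by apply/imsetP; exists b => //; rewrite !inE eq_sym nzb.
    by rewrite Ez !inE eqxx.
  split=> //; apply/eqP/setP => j; rewrite !inE; apply/imsetP/idP.
    case=> y; rewrite !inE => /andP[nyb yB ->].
    by apply: contra nyb => /eqP; rewrite bi0 => /inj ->.
  move=> nj; have /imsetP[y yB jy] : j \in gcolor @: B by rewrite full.
  exists y => //; rewrite !inE yB andbT; apply: contra nj => /eqP yb.
  by rewrite jy yb -bi0.
have [->|] := set_0Vmem D; first by rewrite cards0.
case=> b; rewrite inE => /andP[bB /eqP Eb].
have cardBb : #|B :\ b| = #|I|.-1 by rewrite -cardB (cardsD1 b B) bB.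
have inj : {in B :\ b &, injective gcolor}.
  apply/imset_injP; rewrite Eb cardBb; apply/eqP.
  by rewrite cardsC1.
have BU : B = b |: (B :\ b) by rewrite setD1K.
have cb : gcolor b != i0.
  apply: contra nfull => /eqP cb; rewrite BU imsetU1 cb Eb; apply/eqP/setP => j.
  by rewrite !inE orbN.
have /imsetP[b' b'B bb'] : gcolor b \in gcolor @: (B :\ b) by rewrite Eb !inE.
move: (b'B); rewrite !inE => /andP[nb b'B'].
suff -> : D = [set b; b'] by rewrite cards2 eq_sym nb.
apply/setP => z; rewrite !inE; apply/andP/orP => [[zB /eqP Ez]|].
  apply/orP; rewrite -[_ || _]negbK negb_or; apply/negP => /andP[zb zb'].
  have cz : gcolor z != i0.
    have : gcolor z \in gcolor @: (B :\ b).
      by apply: imset_f; rewrite !inE zb zB.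
    by rewrite Eb !inE.
  have : gcolor z \in gcolor @: (B :\ z) by rewrite Ez !inE.
  case/imsetP => y; rewrite !inE => /andP[yz yB] zy.
  case: (y =P b) => [yb|/eqP nyb].
    have : z = b'.
      by apply: inj; rewrite ?inE ?zb ?zB ?nb // zy yb.
    by move/eqP: zb'.
  have : z = y by apply: inj; rewrite ?inE ?zb ?zB ?nyb.
  by move/eqP: yz => + E; rewrite E.
case=> /eqP ->; first by rewrite bB Eb.
split=> //; apply/eqP; rewrite -Eb; apply/setP => j.
apply/imsetP/imsetP => -[y]; rewrite !inE => /andP[ny yB] ->.
  case: (y =P b) => [->|/eqP nyb]; last by exists y; rewrite // !inE nyb yB.
  by exists b'; rewrite // !inE nb b'B'.
case: (y =P b') => [->|/eqP nyb]; last by exists y; rewrite // !inE nyb yB.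
by exists b; rewrite // !inE eq_sym nb bB.
Qed.

(** As [B] has one member fewer than there are indices, exactly two indices [a]
    and [b] share their worst member.  A completion becomes the worst member for
    one of them, say [p]; it then has to be the best element for [p] among those
    that beat the worst members for all other indices.  Such elements exist,
    because the slack element of [p] is one of them, and the two completions
    differ, since a common one would beat [B] for every index. *)
Lemma even_cells_of_door (B : {set good}) x : dominant B -> #|B| = #|I|.-1 ->
  inl x \in B -> #|[set z in ~: B | dominant (z |: B)]| = 2.
Proof.
move=> dB cardB xB.
have Ipos : 0 < #|I| by apply/card_gt0P; exists i0.
pose m := worst B (inl x).
have mB i : m i \in B by exact: worst_in.
have mle i b : b \in B -> rank i (m i) <= rank i b by exact: worst_le.
have ontom : m @: setT = B by exact: worst_onto.
have [a [b [nab mab]]] : exists a b, a != b /\ m a = m b.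
  have : ~~ injectiveb m.
    apply/negP => /injectiveP inj.
    have := card_imset setT inj; rewrite ontom cardB cardsT => E.
    by move: Ipos; rewrite -E; case: #|I| E => // n /= /eqP; rewrite ltn_eqF.
  by move=> /injectivePn[a [b nab mab]]; exists a, b.
have onto' p : p \in [set a; b] -> forall z, z \in B ->
    exists2 i, i != p & m i = z.
  move=> pab z; rewrite -ontom => /imsetP[i _ ->].
  case: (i =P p) => [->|/eqP]; last by exists i.
  move: pab; rewrite !inE => /orP[]/eqP ->; first by exists b; rewrite // eq_sym.
  by exists a.
have inj' p : p \in [set a; b] -> {in [set~ p] &, injective m}.
  move=> pab; apply/imset_injP.
  suff -> : m @: [set~ p] = B by rewrite cardB cardsC1.
  apply/setP => z; apply/imsetP/idP => [[i _ ->]//|zB].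
  by have [i ip <-] := onto' _ pab _ zB; exists i; rewrite ?inE.
pose M p := [set y | [forall (i | i != p), rank i (m i) < rank i y]].
have MP p y : y \in M p -> forall i, i != p -> rank i (m i) < rank i y.
  by rewrite inE => /forall_inP.
have noM y : ~ (forall i, rank i (m i) < rank i y).
  move=> h; have [i hi] := dominantP _ dB y.
  by have := leq_trans (h i) (hi _ (mB i)); rewrite ltnn.
(* This is where the point [x] in [B] is needed: slack elements beat points. *)
have slackM p : p \in [set a; b] -> inr p \in M p.
  move=> pab; rewrite inE; apply/forall_inP => i ip.
  apply: (leq_ltn_trans (mle i _ xB)).
  by apply: rank_slack_gt; rewrite eq_sym.
pose q p := [arg max_(y > inr p in M p) rank p y].
have qM p : p \in [set a; b] -> q p \in M p.
  by move=> pab; rewrite /q; case: arg_maxnP => //; exact: slackM.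
have qmax p y : p \in [set a; b] -> y \in M p -> rank p y <= rank p (q p).
  move=> pab; rewrite /q; case: arg_maxnP; first exact: slackM.
  by move=> z _ + yM; apply.
have aab : a \in [set a; b] by rewrite !inE eqxx.
have bab : b \in [set a; b] by rewrite !inE eqxx orbT.
have qB p : p \in [set a; b] -> q p \notin B.
  move=> pab; apply/negP => qpB.
  have [i ip mi] := onto' p pab _ qpB.
  by have := MP _ _ (qM p pab) i ip; rewrite mi ltnn.
have qdom p : p \in [set a; b] -> dominant (q p |: B).
  move=> pab; apply/dominantP => y.
  have [yM|nyM] := boolP (y \in M p).
    have [hp|hp] := leqP (rank p y) (rank p (m p)).
      exists p => z; rewrite !inE => /orP[/eqP ->|zB]; first exact: qmax.
      exact: leq_trans (mle p _ zB).
    case: (noM y) => i; case: (i =P p) => [->//|/eqP ip].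
    exact: (MP _ _ yM).
  move: nyM; rewrite inE negb_forall_in => /exists_inP[i ip].
  rewrite -leqNgt => yi; exists i => z; rewrite !inE => /orP[/eqP ->|zB].
    exact: leq_trans yi (ltnW (MP _ _ (qM p pab) i ip)).
  exact: leq_trans yi (mle i _ zB).
have qab : q a != q b.
  apply/eqP => E; apply: (noM (q a)) => i.
  case: (i =P a) => [->|/eqP ia]; last exact: (MP _ _ (qM a aab)).
  by rewrite E; apply: (MP _ _ (qM b bab)).
suff -> : [set z in ~: B | dominant (z |: B)] = [set q a; q b].
  by rewrite cards2 qab.
apply/setP => z; rewrite !inE; apply/andP/orP => [[zB dz]|]; last first.
  by case=> /eqP ->; rewrite qB // qdom.
suff [p pab zp] : exists2 p, p \in [set a; b] & z = q p.
  by move: pab; rewrite !inE => /orP[]/eqP <-; rewrite zp eqxx; [left|right].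
pose m' := worst (z |: B) z.
have zz : z \in z |: B by rewrite setU11.
have m'inj : injective m'.
  have : {in setT &, injective m'}.
    apply/imset_injP; rewrite worst_onto // cardsU1 zB cardB cardsT.
    by rewrite add1n prednK.
  by move=> h i j; apply: h.
have m'm i : m' i != z -> m' i = m i.
  move=> nz; apply/esym; apply: worstE => //.
    by have := worst_in i zz; rewrite !inE (negbTE nz).
  by move=> y yB; apply: worst_le => //; rewrite !inE yB orbT.
have [p pab m'p] : exists2 p, p \in [set a; b] & m' p = z.
  case: (m' a =P z) => [E|/eqP na]; first by exists a.
  case: (m' b =P z) => [E|/eqP nb']; first by exists b.
  have : m' a = m' b by rewrite (m'm _ na) (m'm _ nb').
  by move/m'inj => E; rewrite E eqxx in nab.
exists p => //.
have zM : z \in M p.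
  rewrite inE; apply/forall_inP => i ip.
  have nz : m' i != z by apply: contra ip => /eqP E; rewrite (m'inj i p) ?m'p.
  rewrite -m'm // ltn_neqAle worst_le // andbT.
  by apply: contra nz => /eqP /rank_inj /eqP.
apply: (@rank_inj p); apply/eqP; rewrite eqn_leq qmax //=.
have [i hi] := dominantP _ dz (q p).
case: (i =P p) => [E|/eqP ip]; first by move: hi; rewrite E; apply; rewrite setU11.
have := MP _ _ (qM p pab) i ip.
by rewrite ltnNge hi // !inE mB orbT.
Qed.

(** A door made of slack elements alone consists of those of the indices other
    than [i0], and dominance of a completion only concerns the index [i0]: the
    point that is best for [i0] has to be added. *)
Lemma outer_door (B : {set good}) : door B -> (forall x, inl x \notin B) ->
  #|[set z in ~: B | dominant (z |: B)]| = 1.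
Proof.
move=> /andP[/andP[_ /eqP cB] _] noX.
have {cB} BE : B = [set inr i | i in ~: [set i0]].
  apply/setP => -[x|i]; first by rewrite (negbTE (noX x)); apply/esym/imsetP => -[].
  rewrite mem_imset; last by move=> ? ? [].
  rewrite -cB; apply/idP/imsetP => [iB|[[x xB|j jB]]]; first by exists (inr i).
    by rewrite (negbTE (noX x)) in xB.
  by move=> /= ->.
pose q := [arg max_(y > x0) w i0 y].
have qmax y : w i0 y <= w i0 q by rewrite /q; case: arg_maxnP => // z _; apply.
suff -> : [set z in ~: B | dominant (z |: B)] = [set inl q] by rewrite cards1.
apply/setP => z; rewrite !inE; apply/andP/eqP => [[zB dz]|->]; last first.
  rewrite noX; split=> //; apply/dominantP => -[y|j].
    exists i0 => z0; rewrite !inE => /orP[/eqP ->|]; first by rewrite /= ltnS.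
    rewrite BE => /imsetP[j]; rewrite !inE => ji ->.
    exact/ltnW/rank_slack_gt.
  by exists j => b _; rewrite rank_slack0.
have key y : exists2 i, (inr i \notin z |: B) &
    forall b, b \in z |: B -> rank i (inl y) <= rank i b.
  have [i hi] := dominantP _ dz (inl y); exists i => //.
  by apply/negP => /hi; rewrite rank_slack0.
have ki i : inr i \notin z |: B -> i = i0.
  rewrite !inE BE negb_or mem_imset; last by move=> ? ? [].
  by rewrite !inE negbK => /andP[_ /eqP].
case: z zB dz key ki => [y|i] zB dz key ki.
  have [i /ki -> /(_ (inl y))] := key q.
  rewrite setU11 => /(_ isT) /=; rewrite ltnS => h; congr inl.
  by apply: (@w_inj i0); apply/eqP; rewrite eqn_leq h qmax.
have [j nj _] := key x0; move: (nj); rewrite (ki _ nj) !inE.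
move: zB; rewrite BE !mem_imset; try by move=> ? ? [].
by rewrite !inE negbK => /eqP ->; rewrite eqxx.
Qed.

Lemma outer_is_door : door [set inr i | i in ~: [set i0]].
Proof.
apply/andP; split; first (apply/andP; split).
- apply/dominantP => -[y|j]; last by exists j => b _; rewrite rank_slack0.
  exists i0 => b /imsetP[j]; rewrite !inE => ji ->.
  exact/ltnW/rank_slack_gt.
- by rewrite -imset_comp imset_id.
- by rewrite card_imset ?cardsC1 // => ? ? [].
Qed.

(** The number of incidences between cells and doors is odd, since every door
    has two cells except for the outer one, which has one.  So some cell has an
    odd number of doors, and such a cell shows all colours. *)
Theorem colourful_dominant_set :
  exists2 B : {set good}, dominant B & gcolor @: B = setT.
Proof.
pose inc (B D : {set good}) := (D \subset B) && cell B && door D.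
have card1 (B D : {set good}) : inc B D -> exists2 z, z \notin D & B = z |: D.
  move=> /andP[/andP[DB /andP[_ /eqP cB]] /andP[_ /eqP cD]].
  have : #|B :\: D| = 1.
    rewrite cardsD (setIidPr DB) cB cD.
    have : 0 < #|I| by apply/card_gt0P; exists i0.
    by case: #|I| => // n _; rewrite subSnn.
  move/eqP/cards1P => [z zE]; exists z.
    have : z \in B :\: D by rewrite zE set11.
    by rewrite inE => /andP[].
  by rewrite -zE setUC setDE setUIr setUCr setIT; apply/esym/setUidPr.
have doors B : cell B ->
    odd #|[set D | inc B D]| = (gcolor @: B == setT).
  move=> cB; move: (cB) => /andP[dB /eqP cardB].
  rewrite -(odd_doors_of_cell cardB); congr odd.
  rewrite -(card_in_imset (f := fun b => B :\ b)); last first.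
    move=> b b'; rewrite !inE => /andP[bB _] /andP[b'B _] E.
    apply/eqP; apply: contraT => nb.
    have : b \in B :\ b' by rewrite !inE nb bB.
    by rewrite -E !inE eqxx.
  apply: eq_card => D; rewrite inE; apply/idP/imsetP.
    move=> h; have [z zD BE] := card1 _ _ h; exists z.
      rewrite inE {1}BE setU11 /= {1}BE setU1K //.
      by case/andP: h => _ /andP[/andP[]].
    by rewrite BE setU1K.
  case=> b; rewrite inE => /andP[bB bc] ->; rewrite /inc subD1set cB /= /door.
  rewrite (dominantS (subD1set B b) dB) bc /=.
  by rewrite -cardB (cardsD1 b B) bB.
have cells D : door D ->
    odd #|[set B | inc B D]| = (D == [set inr i | i in ~: [set i0]]).
  move=> dD.
  have cardE : #|[set B | inc B D]| = #|[set z in ~: D | dominant (z |: D)]|.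
    rewrite -(card_in_imset (f := fun z => z |: D)); last first.
      move=> b b'; rewrite !inE => /andP[bD _] /andP[b'D _] E.
      have : b \in b' |: D by rewrite -E setU11.
      by rewrite !inE (negbTE bD) orbF => /eqP.
    apply: eq_card => B; rewrite inE; apply/idP/imsetP.
      move=> h; have [z zD BE] := card1 _ _ h; exists z => //.
      rewrite !inE zD /= -BE.
      by case/andP: h => /andP[_ /andP[]].
    case=> b; rewrite !inE => /andP[bD db] ->; rewrite /inc subsetUr dD /cell db.
    rewrite /= cardsU1 bD andbT; case/andP: dD => _ /eqP ->.
    by rewrite add1n prednK //; apply/card_gt0P; exists i0.
  rewrite cardE; have [x xD|noX] := pickP (fun x => inl x \in D).
    case/andP: (dD) => /andP[dmD _] /eqP cD.
    rewrite (even_cells_of_door dmD cD xD) /=; apply/esym/negP => /eqP E.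
    by move: xD; rewrite E => /imsetP[].
  rewrite outer_door //=; last by move=> x; rewrite noX.
  apply/esym/eqP; move: dD => /andP[/andP[_ /eqP cD] _].
  apply/setP => -[x|i]; first by rewrite noX; apply/esym/imsetP => -[].
  rewrite mem_imset; last by move=> ? ? [].
  rewrite -cD; apply/idP/imsetP => [iB|[[x xB|j jB]]]; first by exists (inr i).
    by rewrite noX in xB.
  by move=> /= ->.
have total : odd (\sum_(B | cell B) #|[set D | inc B D]|).
  have -> : \sum_(B | cell B) #|[set D | inc B D]| =
            \sum_(D | door D) #|[set B | inc B D]|.
    transitivity (\sum_(B | cell B) \sum_(D | door D) inc B D).
      apply: eq_bigr => B cB; rewrite -sum1dep_card [LHS]big_mkcond.
      rewrite [RHS]big_mkcond; apply: eq_bigr => D _.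
      by rewrite /inc; case: (door D); rewrite ?andbF //; case: ifP.
    rewrite exchange_big; apply: eq_bigr => D dD; rewrite -sum1dep_card.
    rewrite [LHS]big_mkcond [RHS]big_mkcond; apply: eq_bigr => B _.
    by rewrite /inc; case: (cell B); rewrite ?andbF //=; case: ifP.
  rewrite (bigD1 _ outer_is_door) /= oddD cells ?outer_is_door // eqxx /=.
  rewrite (big_morph odd oddD (erefl _)) big1 //.
  by move=> D /andP[dD /negbTE nD]; rewrite cells.
have [/existsP[B /andP[/andP[dB _] /eqP fB]]|] :=
    boolP [exists B, cell B && (gcolor @: B == setT)]; first by exists B.
rewrite negb_exists => /forallP none.
suff : odd (\sum_(B | cell B) #|[set D | inc B D]|) = false by rewrite total.
rewrite (big_morph odd oddD (erefl _)) big1 // => B cB.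
by rewrite doors //; have := none B; rewrite cB /= => /negbTE.
Qed.

End Scarf.

(** * Approximate fixed points on a grid *)

Lemma lexi_mono (K a b r s : nat) : (r < K -> a * K + r <= b * K + s ->
  s < K -> a <= b)%N.
Proof.
move=> rK h sK; rewrite leqNgt; apply/negP => ba; move: h.
by rewrite leqNgt => /negP; apply; nia.
Qed.

Section GridBrouwer.
Local Open Scope ring_scope.
Variables (R : realFieldType) (n N : nat).
Notation grid := {ffun 'I_n -> 'I_N.+1}.
Variables (G : grid -> 'I_n -> R) (e : R).
Hypothesis N0 : (0 < N)%N.
Hypothesis G01 : forall p i, 0 <= G p i <= 1.
Hypothesis Gunif : forall p q : grid,
  (forall i, (p i <= q i + n)%N && (q i <= p i + n)%N) ->
  forall i, `|G p i - G q i| <= e.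

(** [None] stands for an extra coordinate that is largest where the sum of the
    others is smallest; it plays the part of the additional barycentric
    coordinate of a simplex. *)
Definition gkey (i : option 'I_n) (x : grid) : nat :=
  if i is Some j then x j else (n * N - \sum_j x j)%N.

(** The ranking by [gkey], with ties broken by the enumeration of the grid. *)
Definition gpref (i : option 'I_n) (x : grid) : nat :=
  (gkey i x * #|{: grid}| + enum_rank x)%N.

Lemma gpref_inj i : injective (gpref i).
Proof.
move=> x y /(congr1 (modn^~ #|{: grid}|)).
by rewrite !modnMDl !modn_small // => /val_inj/enum_rank_inj.
Qed.

Lemma gpref_le i x y : (gpref i x <= gpref i y -> gkey i x <= gkey i y)%N.
Proof. by move=> h; apply: (lexi_mono _ h). Qed.

(** The condition [x i < N] ensures that a point of colour [Some i] still has
    room to move upwards; for a point of colour [None] the map increases no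
    coordinate. *)
Definition gcol (x : grid) : option 'I_n :=
  [pick i | (x i < N)%N && ((x i)%:R / N%:R <= G x i)].

Lemma sum_grid_le (x : grid) : (\sum_j x j <= n * N)%N.
Proof.
rewrite -[X in (_ <= X * _)%N](card_ord n) -sum_nat_const.
by apply: leq_sum => j _; rewrite -ltnS.
Qed.

(** Let [B] be dominant with all colours, [m] the coordinatewise minimum of its
    points over the active coordinates, and [y] the grid point one step above
    [m].  Then [y] beats all of [B] in the active coordinates, so by dominance
    the sum of its coordinates is at least that of any point of [B].  This
    confines the points of [B] to a box of side [n] above [m].  At the point of
    colour [None] the map increases no coordinate; it decreases an active
    coordinate by little, since it does not decrease it at a nearby point, and
    the other coordinates are within [n] of zero. *)
Theorem grid_approx_fixpoint :
  exists p : grid, forall i, `|G p i - (p i)%:R / N%:R| <= e + n%:R / N%:R.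
Proof.
have [B dB fullB] :=
  colourful_dominant_set gpref_inj [ffun => ord0] None gcol.
have NR : 0 < N%:R :> R by rewrite ltr0n.
have colB i : exists2 b, b \in B & gcolor gcol b = i.
  have : i \in gcolor gcol @: B by rewrite fullB.
  by case/imsetP => b bB ->; exists b.
have colS j : inr (Some j) \notin B -> exists x : grid,
    [/\ inl x \in B, (x j < N)%N & (x j)%:R / N%:R <= G x j].
  move=> nj; have [[x|k] bB /=] := colB (Some j); last first.
    by move=> E; rewrite E in bB; rewrite bB in nj.
  rewrite /gcol; case: pickP => // i /andP[h1 h2] [E]; subst i.
  by exists x; split.
have dom y : exists i, inr i \notin B /\
    forall x, inl x \in B -> (gkey i y <= gkey i x)%N.
  have [i hi] := dominantP _ _ dB (inl y); exists i; split.
    by apply/negP => /hi; rewrite rank_slack0.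
  by move=> x /hi /=; rewrite ltnS => /gpref_le.
(* If the index [None] were inactive, the top corner would beat [B]. *)
have nNone : inr None \notin B.
  apply/negP => hN.
  have [[j|] [nj hj]] := dom [ffun => ord_max]; last by rewrite hN in nj.
  have [x [xB xN _]] := colS _ nj.
  by have := hj _ xB; rewrite /= ffunE /= leqNgt xN.
have [p pB cp] : exists2 p : grid, inl p \in B & gcol p = None.
  by have [[p|j] bB /= E] := colB None; [exists p|rewrite E (negbTE nNone) in bB].
pose xmin (j : 'I_n) : grid := [arg min_(x < p | inl x \in B) (x j : nat)].
have xminB j : inl (xmin j) \in B by rewrite /xmin; case: arg_minnP.
have xmin_le j x : inl x \in B -> (xmin j j <= x j)%N.
  by move=> xB; rewrite /xmin; case: arg_minnP => // y _; apply.
have xminN j : inr (Some j) \notin B -> (xmin j j < N)%N.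
  by move=> /colS[x [/(xmin_le j) h xN _]]; apply: leq_ltn_trans xN.
pose m (j : 'I_n) : nat := if inr (Some j) \in B then 0 else xmin j j.
have m_le j x : inl x \in B -> (m j <= x j)%N.
  by move=> xB; rewrite /m; case: ifP => // _; exact: xmin_le.
have sumB x : inl x \in B -> (\sum_j x j <= \sum_j (m j).+1)%N.
  move=> xB.
  pose y : grid := [ffun j => if inr (Some j) \in B then ord0
                              else inord (xmin j j).+1].
  have [[j|] [nj hj]] := dom y.
    have := hj _ (xminB j); rewrite /= ffunE (negbTE nj) inordK ?ltnn //.
    by rewrite ltnS xminN.
  have yle : (\sum_j y j <= \sum_j (m j).+1)%N.
    apply: leq_sum => j _; rewrite ffunE /m; case: ifPn => // h.
    by rewrite inordK // ltnS xminN.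
  apply: leq_trans yle; have /= := hj _ xB.
  have := sum_grid_le x; have := sum_grid_le y.
  by move: (\sum_j y j)%N (\sum_j x j)%N (n * N)%N => ? ? ?; lia.
have close x j : inl x \in B -> (x j <= m j + n)%N.
  move=> xB; have := sumB _ xB.
  have -> : (\sum_k (m k).+1 = \sum_k m k + n)%N.
    under eq_bigr do rewrite -addn1.
    by rewrite big_split /= sum1_card card_ord.
  rewrite (bigD1 j) //= [X in (_ <= X + _)%N](bigD1 j) //=.
  have : (\sum_(i < n | i != j) m i <= \sum_(i < n | i != j) x i)%N.
    by apply: leq_sum => i _; exact: m_le.
  move: (\sum_(i < n | i != j) m i)%N (\sum_(i < n | i != j) x i)%N => ? ?.
  by lia.
have near x y : inl x \in B -> inl y \in B -> forall i,
    ((x i <= y i + n)%N && (y i <= x i + n)%N).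
  move=> xB yB i.
  have := close _ i xB; have := close _ i yB.
  by have := m_le i _ xB; have := m_le i _ yB; lia.
exists p => i; rewrite ler_norml.
have Gp_le : G p i <= (p i)%:R / N%:R.
  move: cp; rewrite /gcol; case: pickP => // h _.
  have := h i => /= /negbT; rewrite negb_and -leqNgt -ltNge.
  case/orP => [Ni|/ltW //]; have [_ h1] := andP (G01 p i).
  by apply: (le_trans h1); rewrite ler_pdivlMr // mul1r ler_nat.
have e0 : 0 <= e.
  have refl j : ((p j <= p j + n)%N && (p j <= p j + n)%N) by rewrite leq_addr.
  by have := Gunif refl i; rewrite subrr normr0.
have nN0 : 0 <= n%:R / N%:R :> R by rewrite divr_ge0.
apply/andP; split; last by lra.
have [iB|iB] := boolP (inr (Some i) \in B).
  have h : (p i <= n)%N by have := close _ i pB; rewrite /m iB.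
  have hR : (p i)%:R / N%:R <= n%:R / N%:R :> R by rewrite ler_pM2r ?invr_gt0 // ler_nat.
  by have /andP[h0 _] := G01 p i; lra.
have [x [xB _ xG]] := colS _ iB.
have := Gunif (near _ _ pB xB) i; rewrite ler_norml => /andP[h1 h2].
have /andP[h3 _] := near _ _ pB xB i.
have h4 : (p i)%:R / N%:R <= (x i)%:R / N%:R + n%:R / N%:R :> R.
  by rewrite -mulrDl ler_pM2r ?invr_gt0 // -natrD ler_nat.
lra.
Qed.

End GridBrouwer.

From mathcomp Require Import all_classical all_reals all_analysis.
From mathcomp Require Import measurable_realfun.
Import numFieldNormedType.Exports.
Local Open Scope classical_set_scope.
Local Open Scope ring_scope.

(** * A compact class of functions *)

Section SlopeClass.
Variables (R : realType) (t0 L : R) (phi : R -> R) (a b : R).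
Hypotheses (L0 : 0 < L) (a0 : 0 < a) (b0 : 0 < b).

(** The domain of the fixed-point theorem.  Fixing the functions to the left of
    [t0] and to the right of [t0 + L] makes equality on the interval the same
    as equality, and makes uniform closeness a statement about all reals. *)
Record slope_class (y : R -> R) : Prop := SlopeClass {
  sc_init : forall t, t <= t0 -> y t = phi t;
  sc_lower : forall s t, t0 <= s -> s <= t -> - a * (t - s) <= y t - y s;
  sc_upper : forall s t, t0 <= s -> s <= t -> y t - y s <= b * (t - s);
  sc_final : forall t, t0 + L <= t -> y t = y (t0 + L)
}.

Lemma sc_lipschitz y s t : slope_class y -> t0 <= s -> t0 <= t ->
  `|y t - y s| <= (a + b) * `|t - s|.
Proof.
move=> Ky; wlog st : s t / s <= t => [h ts0 tt0|].
  have [st|/ltW ts] := leP s t; first exact: h.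
  by rewrite distrC (distrC t); apply: h.
move=> hs _; have h1 := sc_lower Ky hs st; have h2 := sc_upper Ky hs st.
rewrite ler_norml (ger0_norm (x := t - s)) ?subr_ge0 //.
have : 0 <= a * (t - s) by rewrite mulr_ge0 ?subr_ge0 // ltW.
have : 0 <= b * (t - s) by rewrite mulr_ge0 ?subr_ge0 // ltW.
by move=> *; apply/andP; split; lra.
Qed.

Lemma finite_net (d : R) : 0 < d -> exists (n : nat) (u : 'I_n -> R),
  (forall i, t0 <= u i) /\
  forall t, t0 <= t <= t0 + L -> exists i, `|t - u i| <= d.
Proof.
move=> d0; pose n := (Num.truncn (L / d)).+1.
exists n, (fun i => t0 + i%:R * d); split.
  by move=> i; rewrite lerDl mulr_ge0 // ltW.
move=> t /andP[ht0 ht1].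
have q0 : 0 <= (t - t0) / d by rewrite divr_ge0 ?subr_ge0 // ltW.
have [h1 h2] := andP (truncn_itv q0).
have kn : (Num.truncn ((t - t0) / d) < n)%N.
  rewrite /n ltnS; apply: le_truncn.
  by rewrite ler_pM2r ?invr_gt0 // lerBlDl.
exists (Ordinal kn) => /=.
move: h1 h2; rewrite ler_pdivlMr // ltr_pdivrMr //.
move: (Num.truncn _) => k; rewrite -[k.+1%:R]natr1 mulrDl mul1r.
by move=> h1 h2; rewrite ler_norml; apply/andP; split; lra.
Qed.

(** The theorem of Arzela and Ascoli.  Along an ultrafilter every value [z t]
    converges, and the common Lipschitz constant upgrades convergence on a
    finite net to uniform convergence.  The form for filters serves both for
    sequences and for chains. *)
Lemma slope_class_compact (F : set_system (R -> R)) : ProperFilter F ->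
  F slope_class ->
  exists y, slope_class y /\ forall A e, F A -> 0 < e ->
    exists z, [/\ A z, slope_class z & forall t, `|z t - y t| <= e].
Proof.
move=> PF FK; have [U [UU sFU]] := ultraFilterLemma PF.
have PU : ProperFilter U by exact: ultra_proper.
have UK : U slope_class by exact: sFU.
have ev t : exists l : R, (z t @[z --> U]) --> l.
  pose lo := if t <= t0 then phi t else phi t0 - a * (t - t0).
  pose hi := if t <= t0 then phi t else phi t0 + b * (t - t0).
  have := @segment_compact R lo hi.
  move=> /(_ ((fun z : R -> R => z t) @ U) _) [|l [_ cl]]; last first.
    exists l => V Vl; have [//|UV] := @in_ultra_setVsetC _ U [set z | V (z t)] UU.
    by have [v []] := cl (~` V) V UV Vl.
  suff : U [set z : R -> R | `[lo, hi]%classic (z t)] by [].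
  apply: filterS UK => z Kz /=; rewrite in_itv /= /lo /hi.
  case: (leP t t0) => [h|/ltW h]; first by rewrite (sc_init Kz h) !lexx.
  have := sc_lower Kz (lexx t0) h; have := sc_upper Kz (lexx t0) h.
  by rewrite (sc_init Kz (lexx _)) => *; apply/andP; split; lra.
have [y yU] := choice ev.
have Unear t e : 0 < e -> U [set z | `|z t - y t| < e].
  move=> e0; have /cvgr_dist_lt /(_ _ e0) := yU t.
  by apply: filterS => z; rewrite /= distrC.
have Upick A s t e : U A -> 0 < e ->
    exists z, [/\ A z, slope_class z, `|z s - y s| < e & `|z t - y t| < e].
  move=> UA e0.
  have /filter_ex [z [[Az Kz] [h1 h2]]] : U ((A `&` slope_class) `&`
      ([set z | `|z s - y s| < e] `&` [set z | `|z t - y t| < e])).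
    by apply: filterI; apply: filterI => //; exact: Unear.
  by exists z.
have Ky : slope_class y.
  split=> [t tt0|s t hs st|s t hs st|t ht].
  - apply/eqP; rewrite -subr_eq0 -normr_le0; apply/ler_addgt0Pl => e e0.
    have [z [_ Kz + _]] := Upick _ t t _ filterT e0.
    by rewrite (sc_init Kz) // distrC addr0 => /ltW.
  - apply/ler_addgt0Pl => e e0.
    have e2 : 0 < e / 2 by rewrite divr_gt0.
    have [z [_ Kz]] := Upick _ s t _ filterT e2.
    rewrite !ltr_norml => /andP[h1 h2] /andP[h3 h4].
    by have := sc_lower Kz hs st; lra.
  - apply/ler_addgt0Pl => e e0.
    have e2 : 0 < e / 2 by rewrite divr_gt0.
    have [z [_ Kz]] := Upick _ s t _ filterT e2.
    rewrite !ltr_norml => /andP[h1 h2] /andP[h3 h4].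
    by have := sc_upper Kz hs st; lra.
  - apply/eqP; rewrite -subr_eq0 -normr_le0; apply/ler_addgt0Pl => e e0.
    have e2 : 0 < e / 2 by rewrite divr_gt0.
    have [z [_ Kz]] := Upick _ (t0 + L) t _ filterT e2.
    rewrite (sc_final Kz ht) !ltr_norml => /andP[h1 h2] /andP[h3 h4].
    by rewrite addr0 ler_norml; apply/andP; split; lra.
exists y; split=> // A e FA e0.
have ab0 : 0 < a + b by rewrite addr_gt0.
have [n [u [ut0 hu]]] : exists (n : nat) (u : 'I_n -> R),
  (forall i, t0 <= u i) /\ forall t, t0 <= t <= t0 + L -> exists i,
     `|t - u i| <= e / (3 * (a + b)).
  by apply: finite_net; rewrite divr_gt0 // mulr_gt0.
have Unet : U [set z | forall i, `|z (u i) - y (u i)| < e / 3].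
  have : \forall z \near U, forall i : 'I_n, `|z (u i) - y (u i)| < e / 3.
    apply: filter_forall => i; apply: Unear; by rewrite divr_gt0.
  exact.
have /filter_ex [z [Az [Kz hz]]] : U (A `&` (slope_class `&`
    [set z | forall i, `|z (u i) - y (u i)| < e / 3])).
  by apply: filterI; [exact: sFU|apply: filterI].
exists z; split=> //.
have main t : t0 <= t <= t0 + L -> `|z t - y t| <= e.
  move=> ht; have [i hi] := hu _ ht; have [ht0 _] := andP ht.
  have lip w : slope_class w -> `|w t - w (u i)| <= e / 3.
    move=> Kw; apply: le_trans (sc_lipschitz Kw (ut0 i) ht0) _.
    apply: le_trans (_ : (a + b) * (e / (3 * (a + b))) <= _).
      by rewrite ler_pM2l.
    by rewrite le_eqVlt; apply/orP; left; apply/eqP; field; rewrite gt_eqF.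
  have := lip _ Kz; have := lip _ Ky; have := hz i.
  rewrite !ler_norml !ltr_norml => /andP[? ?] /andP[? ?] /andP[? ?].
  by apply/andP; split; lra.
move=> t; have [tt0|/ltW tt0] := leP t t0.
  by rewrite (sc_init Kz tt0) (sc_init Ky tt0) subrr normr0 ltW.
have [tt1|/ltW tt1] := leP t (t0 + L); first by apply: main; rewrite tt0.
rewrite (sc_final Kz tt1) (sc_final Ky tt1); apply: main.
by rewrite lexx andbT lerDl ltW.
Qed.

(** The rate [1 / (j + 1)] is a convenient normalization of uniform convergence,
    and [j <= s j] is all that is needed of a subsequence. *)
Lemma slope_class_seq_compact (y_ : nat -> R -> R) :
  (forall j, slope_class (y_ j)) ->
  exists y (s : nat -> nat), [/\ slope_class y, forall j, (j <= s j)%N &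
    forall j t, `|y_ (s j) t - y t| <= j.+1%:R^-1].
Proof.
move=> Ky_; have [|y [Ky hy]] := @slope_class_compact (y_ @ \oo) _.
  by exists 0%N => // j _; exact: Ky_.
have /choice[s hs] : forall j, exists i, (j <= i)%N /\
    forall t, `|y_ i t - y t| <= j.+1%:R^-1.
  move=> j; have [||z [[i /= ji <-] _ hz]] :=
    hy [set y_ i | i in [set i | (j <= i)%N]] j.+1%:R^-1.
  - by exists j => // i /= ji; exists i.
  - by rewrite invr_gt0.
  by exists i.
by exists y, s; split=> // j; have [] := hs j.
Qed.

(** * Fixed points by finite-dimensional approximation *)

Definition seq_continuous (T : (R -> R) -> R -> R) := forall y_ y,
  (forall j, slope_class (y_ j)) -> slope_class y ->
  (forall j t, `|y_ j t - y t| <= j.+1%:R^-1) ->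
  forall t, T (y_ j) t @[j --> \oo] --> T y t.

Variable T : (R -> R) -> R -> R.
Hypothesis TK : forall y, slope_class y -> slope_class (T y).
Hypothesis Tcont : seq_continuous T.

(** Sequential continuity on a compact set is uniform: two sequences that violate
    it have a common limit. *)
Lemma unif_continuous_at_nodes n (u : 'I_n -> R) e : 0 < e -> exists2 d, 0 < d &
  forall y z, slope_class y -> slope_class z ->
    (forall t, `|y t - z t| <= d) -> forall i, `|T y (u i) - T z (u i)| <= e.
Proof.
move=> e0; apply: contrapT => nd.
have /choice[yz hyz] : forall j : nat, exists yz : (R -> R) * (R -> R),
    [/\ slope_class yz.1, slope_class yz.2,
        forall t, `|yz.1 t - yz.2 t| <= (2 * j.+1%:R)^-1 &
        ~ forall i, `|T yz.1 (u i) - T yz.2 (u i)| <= e].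
  move=> j; apply: contrapT => nyz; apply: nd.
  exists (2 * j.+1%:R)^-1; first by rewrite invr_gt0 mulr_gt0.
  move=> y z Ky Kz h; apply: contrapT => nh; apply: nyz.
  by exists (y, z); split.
have [|y [s [Ky sj hy]]] := @slope_class_seq_compact (fun j => (yz j).1).
  by move=> j; have [] := hyz j.
(* Halving the error leaves room for the distance between the two sequences. *)
pose s' (j : nat) := s j.*2.+1.
have s2 (j : nat) : j.*2.+2%:R^-1 = (2 * j.+1%:R)^-1 :> R.
  by rewrite -doubleS -mul2n natrM.
have js (j : nat) : (2 * (s' j).+1%:R)^-1 <= (2 * j.+1%:R)^-1 :> R.
  rewrite lef_pV2 ?posrE ?mulr_gt0 // ler_pM2l // ler_nat ltnS.
  by apply: leq_trans (sj _); rewrite -addnn -addnS leq_addr.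
have sum2 (j : nat) : (2 * j.+1%:R)^-1 + (2 * j.+1%:R)^-1 = j.+1%:R^-1 :> R.
  have : j.+1%:R != 0 :> R by rewrite pnatr_eq0.
  by move: (j.+1%:R : R) => x x0; field.
have pos2 (j : nat) : 0 <= (2 * j.+1%:R)^-1 :> R by rewrite invr_ge0.
have cy : forall t, T (yz (s' j)).1 t @[j --> \oo] --> T y t.
  apply: Tcont => //; first by move=> j; have [] := hyz (s' j).
  move=> j t; apply: le_trans (hy _ _) _; rewrite s2 -(sum2 j).
  by rewrite lerDl.
have cz : forall t, T (yz (s' j)).2 t @[j --> \oo] --> T y t.
  apply: Tcont => //; first by move=> j; have [] := hyz (s' j).
  move=> j t; have [_ _ /(_ t) h _] := hyz (s' j).
  have h2 := hy j.*2.+1 t; rewrite s2 -/(s' j) in h2.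
  have -> : (yz (s' j)).2 t - y t = ((yz (s' j)).1 t - y t) -
    ((yz (s' j)).1 t - (yz (s' j)).2 t) by ring.
  apply: le_trans (ler_normB _ _) _; rewrite -(sum2 j).
  by apply: lerD => //; apply: le_trans h _.
have : \forall j \near \oo, forall i,
    `|T (yz (s' j)).1 (u i) - T (yz (s' j)).2 (u i)| < e.
  apply: filter_forall => i.
  have : (T (yz (s' j)).1 (u i) - T (yz (s' j)).2 (u i)) @[j --> \oo] --> 0.
    by rewrite -[X in _ --> X](subrr (T y (u i))); apply: cvgB; [exact: cy|exact: cz].
  move/cvgr0Pnorm_lt => /(_ _ e0); exact.
case/filter_ex => j hj; have [_ _ _] := hyz (s' j); apply => i.
exact/ltW.
Qed.

Section Polygon.
Variables (n : nat) (h : R).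
Hypotheses (n0 : (0 < n)%N) (h0 : 0 < h) (nh : n%:R * h = L).

Definition node (i : nat) : R := t0 + i%:R * h.

(** The difference of the two minima is the length of the part of the [i]-th
    piece to the left of [t], so that [c i] is the slope on that piece. *)
Definition polygon (c : 'I_n -> R) (t : R) : R :=
  if t <= t0 then phi t else
  phi t0 + \sum_(i < n) c i * (Num.min t (node i.+1) - Num.min t (node i)).

Lemma nodeS i : node i.+1 = node i + h.
Proof. by rewrite /node -natr1 mulrDl mul1r addrA. Qed.

Lemma node_ge i : t0 <= node i.
Proof. by rewrite lerDl mulr_ge0 // ltW. Qed.

Lemma node_mono i j : (i <= j)%N -> node i <= node j.
Proof. by move=> ij; rewrite lerD2l ler_pM2r // ler_nat. Qed.

Lemma node_last : node n = t0 + L. Proof. by rewrite /node nh. Qed.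

Lemma polygonE c t : t0 <= t -> polygon c t =
  phi t0 + \sum_(i < n) c i * (Num.min t (node i.+1) - Num.min t (node i)).
Proof.
rewrite le_eqVlt /polygon => /orP[/eqP <-|]; last by rewrite ltNge => /negbTE ->.
rewrite lexx big1 ?addr0 // => i _.
by rewrite !(min_idPl (node_ge _)) subrr mulr0.
Qed.

Lemma polygon_sub c s t : t0 <= s -> s <= t -> polygon c t - polygon c s =
  \sum_(i < n) c i * ((Num.min t (node i.+1) - Num.min t (node i)) -
                      (Num.min s (node i.+1) - Num.min s (node i))).
Proof.
move=> hs st; rewrite !polygonE // ?(le_trans hs) // opprD addrACA subrr add0r.
by rewrite -sumrB; apply: eq_bigr => i _; rewrite [RHS]mulrBr.
Qed.

Lemma polygon_weight_ge0 s t i : s <= t ->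
  0 <= (Num.min t (node i.+1) - Num.min t (node i)) -
       (Num.min s (node i.+1) - Num.min s (node i)).
Proof.
move=> st; have := node_mono (leqnSn i).
case: (leP t (node i.+1)); case: (leP t (node i));
  by case: (leP s (node i.+1)); case: (leP s (node i)); lra.
Qed.

Lemma polygon_weight_sum s t : t0 <= s -> s <= t ->
  \sum_(i < n) ((Num.min t (node i.+1) - Num.min t (node i)) -
                (Num.min s (node i.+1) - Num.min s (node i)))
  = Num.min t (t0 + L) - Num.min s (t0 + L).
Proof.
move=> hs st; rewrite sumrB.
have tele u : t0 <= u -> \sum_(i < n)
    (Num.min u (node i.+1) - Num.min u (node i)) = Num.min u (t0 + L) - t0.
  move=> hu; rewrite -(big_mkord xpredT
     (fun i => Num.min u (node i.+1) - Num.min u (node i))).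
  rewrite telescope_sumr // node_last.
  by rewrite /node mul0r addr0 (min_idPr hu).
by rewrite !tele ?(le_trans hs) //; ring.
Qed.

Lemma polygon_slope_class c : (forall i, - a <= c i <= b) ->
  slope_class (polygon c).
Proof.
move=> hc; have wle s t : s <= t ->
    Num.min t (t0 + L) - Num.min s (t0 + L) <= t - s.
  by move=> st; case: (leP t (t0 + L)); case: (leP s (t0 + L)); lra.
split=> [t tt0|s t hs st|s t hs st|t ht].
- by rewrite /polygon tt0.
- rewrite polygon_sub //.
  apply: le_trans (_ : - a * (Num.min t (t0 + L) - Num.min s (t0 + L)) <= _).
    by rewrite !mulNr lerN2 ler_pM2l // wle.
  rewrite -polygon_weight_sum // mulr_sumr; apply: ler_sum => i _.
  by rewrite ler_wpM2r ?polygon_weight_ge0 //; case/andP: (hc i).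
- rewrite polygon_sub //.
  apply: le_trans (_ : _ <= b * (Num.min t (t0 + L) - Num.min s (t0 + L))) _.
    rewrite -polygon_weight_sum // mulr_sumr; apply: ler_sum => i _.
    by rewrite ler_wpM2r ?polygon_weight_ge0 //; case/andP: (hc i).
  by rewrite ler_pM2l // wle.
- have t0L : t0 <= t0 + L by rewrite lerDl ltW.
  apply/eqP; rewrite -subr_eq0 polygon_sub //; apply/eqP/big1 => i _.
  have h1 : node i.+1 <= t0 + L by rewrite -node_last; apply: node_mono.
  have h2 : node i <= t0 + L by rewrite -node_last; apply/node_mono/ltnW.
  rewrite (min_idPr h1) (min_idPr h2) (min_idPr (le_trans h1 ht)).
  by rewrite (min_idPr (le_trans h2 ht)) subrr mulr0.
Qed.

Lemma polygon_node c (i : 'I_n) :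
  polygon c (node i.+1) - polygon c (node i) = c i * h.
Proof.
rewrite polygon_sub ?node_ge ?node_mono // (bigD1 i) //= big1 ?addr0.
  rewrite minxx (min_idPr (node_mono (leqnSn i))) minxx.
  rewrite (min_idPl (node_mono (leqnSn i))) subrr subr0; congr (_ * _).
  by rewrite nodeS addrAC subrr add0r.
move=> j ji; have [ij|ij] := ltnP i j.
  rewrite !(min_idPl _) ?subrr ?mulr0 //; apply: node_mono => //.
  - exact: ltnW.
  - by apply: leqW; apply: ltnW.
  - exact: leqW.
have {}ij : (j < i)%N by rewrite ltn_neqAle ij andbT.
rewrite !(min_idPr _) ?subrr ?mulr0 //; apply: node_mono => //.
- exact: ltnW.
- by apply: leqW; apply: ltnW.
- exact: leqW.
Qed.

Lemma polygon_dist c c' e t : (forall i, `|c i - c' i| <= e) ->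
  `|polygon c t - polygon c' t| <= e * L.
Proof.
move=> hc; have e0 : 0 <= e by apply: le_trans (hc (Ordinal n0)).
have [tt0|/ltW tt0] := leP t t0.
  by rewrite /polygon tt0 subrr normr0 mulr_ge0 // ltW.
rewrite !polygonE // opprD addrACA subrr add0r -sumrB.
apply: le_trans (ler_norm_sum _ _ _) _.
apply: le_trans (_ : \sum_(i < n)
    e * ((Num.min t (node i.+1) - Num.min t (node i)) -
         (Num.min t0 (node i.+1) - Num.min t0 (node i))) <= _).
  apply: ler_sum => i _; rewrite -mulrBl normrM.
  rewrite !(min_idPl (node_ge _)) subrr subr0.
  have w0 := polygon_weight_ge0 i tt0.
  rewrite !(min_idPl (node_ge _)) subrr subr0 in w0.
  by rewrite [X in _ * X]ger0_norm // ler_wpM2r.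
rewrite -mulr_sumr polygon_weight_sum // ler_wpM2l //.
by have := L0; case: (leP t (t0 + L)); case: (leP t0 (t0 + L)); lra.
Qed.

End Polygon.

End SlopeClass.

Section FixedPoints.
Variables (R : realType) (t0 L : R) (phi : R -> R) (a b : R).
Hypotheses (L0 : 0 < L) (a0 : 0 < a) (b0 : 0 < b).
Notation K := (slope_class t0 L phi a b).
Variable T : (R -> R) -> R -> R.
Hypothesis TK : forall y, K y -> K (T y).
Hypothesis Tcont : seq_continuous t0 L phi a b T.

(** The slopes of a polygon with [n] pieces range over a cube.  An approximate
    fixed point of the map [G] that sends the slopes of [y] to the difference
    quotients of [T y] between consecutive nodes is a polygon [y] that nearly
    agrees with [T y] at the nodes, and hence everywhere, because both functions
    have the same Lipschitz constant. *)
Lemma approx_fixpoint e : 0 < e ->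
  exists y, K y /\ forall t, `|T y t - y t| <= e.
Proof.
move=> e0; have ab0 : 0 < a + b by rewrite addr_gt0.
pose n := (Num.truncn (4 * (a + b) * L / e)).+1.
pose h := L / n%:R.
have n0 : (0 < n)%N by [].
have nR : 0 < n%:R :> R by rewrite ltr0n.
have h0 : 0 < h by rewrite divr_gt0.
have nh : n%:R * h = L by rewrite mulrC divfK // gt_eqF.
have abh : (a + b) * h <= e / 4.
  rewrite /h mulrA ler_pdivrMr //.
  have := truncnS_gt (4 * (a + b) * L / e); rewrite -/n ltr_pdivrMr // => H.
  by lra.
pose nd := node t0 h.
have nd0 i : t0 <= nd i by apply: node_ge.
have ndS i : nd i.+1 = nd i + h by apply: nodeS.
(* The accuracy for the slopes: over the length [L] it adds up to [e / 2]. *)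
pose eps := e / (2 * (a + b) * L).
have eps0 : 0 < eps by rewrite divr_gt0 // !mulr_gt0.
have epsL : (a + b) * L * eps = e / 2.
  by rewrite /eps; field; rewrite !gt_eqF.
clearbody h eps.
pose eT := (a + b) * h * eps / 4.
have eT0 : 0 < eT by rewrite divr_gt0 // !mulr_gt0.
have [d d0 hd] := unif_continuous_at_nodes L0 a0 b0 Tcont
  (fun i : 'I_n.+1 => nd i) eT0.
pose N := (Num.truncn (n%:R * (a + b) * L / d + 2 * n%:R / eps)).+1.
have N0 : (0 < N)%N by [].
have NR : 0 < N%:R :> R by rewrite ltr0n.
have Nbig : n%:R * (a + b) * L / d + 2 * n%:R / eps < N%:R.
  exact: truncnS_gt.
have p1 : 0 <= n%:R * (a + b) * L / d.
  by rewrite divr_ge0 ?mulr_ge0 // ltW.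
have p2 : 0 <= 2 * n%:R / eps by rewrite divr_ge0 ?mulr_ge0 // ltW.
have Nd : n%:R * (a + b) * L <= d * N%:R.
  have : n%:R * (a + b) * L / d <= N%:R by lra.
  by rewrite ler_pdivrMr // [N%:R * d]mulrC.
have Neps : n%:R / N%:R <= eps / 2.
  have : 2 * n%:R / eps < N%:R by lra.
  by rewrite ltr_pdivrMr // ler_pdivrMr // => ?; lra.
pose slope (p : {ffun 'I_n -> 'I_N.+1}) (i : 'I_n) : R :=
  - a + (a + b) * ((p i)%:R / N%:R).
have slopeab p i : - a <= slope p i <= b.
  have u0 : 0 <= (p i)%:R / N%:R :> R by rewrite divr_ge0.
  have u1 : (p i)%:R / N%:R <= 1 :> R.
    by rewrite ler_pdivrMr // mul1r ler_nat -ltnS.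
  have : 0 <= (a + b) * ((p i)%:R / N%:R) by rewrite mulr_ge0 // ltW.
  have : (a + b) * ((p i)%:R / N%:R) <= (a + b) * 1 by rewrite ler_pM2l.
  by rewrite /slope => *; apply/andP; split; lra.
pose Y p := polygon t0 phi h (slope p).
have KY p : K (Y p) by apply: polygon_slope_class.
pose G p (i : 'I_n) := ((T (Y p) (nd i.+1) - T (Y p) (nd i)) / h + a) / (a + b).
have [||p hp] := @grid_approx_fixpoint R n N G (eps / 2) N0.
- move=> p i; have Kt := TK (KY p).
  have st : nd i <= nd i.+1 by rewrite ndS lerDl ltW.
  have := sc_lower Kt (nd0 i) st; have := sc_upper Kt (nd0 i) st.
  have -> : nd i.+1 - nd i = h by rewrite ndS; ring.
  move=> h1 h2.
  rewrite /G ler_pdivlMr // ler_pdivrMr // mul0r mul1r; apply/andP; split.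
    by rewrite -lerBlDr sub0r ler_pdivlMr.
  by rewrite -lerBrDr addrAC subrr add0r ler_pdivrMr.
- move=> p q pq i.
  have dpq : forall t, `|Y p t - Y q t| <= d.
    move=> t; apply: le_trans (_ : ((a + b) * (n%:R / N%:R)) * L <= _).
      apply: polygon_dist => // j; rewrite /slope opprD addrACA subrr add0r.
      rewrite -mulrBr normrM (gtr0_norm ab0) ler_pM2l // -mulrBl normrM.
      rewrite [X in _ * X]gtr0_norm ?invr_gt0 // ler_pM2r ?invr_gt0 //.
      have /andP[h1 h2] := pq j.
      rewrite ler_norml; have : (p j)%:R <= (q j)%:R + n%:R :> R.
        by rewrite -natrD ler_nat.
      have : (q j)%:R <= (p j)%:R + n%:R :> R by rewrite -natrD ler_nat.
      by move=> *; apply/andP; split; lra.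
    rewrite mulrAC mulrA ler_pdivrMr //.
    by apply: le_trans Nd; rewrite le_eqVlt; apply/orP; left; apply/eqP; ring.
  have c1 := hd _ _ (KY p) (KY q) dpq (inord i).
  have c2 := hd _ _ (KY p) (KY q) dpq (inord i.+1).
  rewrite !inordK in c1 c2; last 2 first.
  - by rewrite ltnS.
  - by rewrite ltnS ltnW.
  have -> : G p i - G q i = ((T (Y p) (nd i.+1) - T (Y q) (nd i.+1)) -
      (T (Y p) (nd i) - T (Y q) (nd i))) / (h * (a + b)).
    by rewrite /G; field; rewrite !gt_eqF.
  rewrite normrM [X in _ * X]gtr0_norm ?invr_gt0 ?mulr_gt0 //.
  rewrite ler_pdivrMr ?mulr_gt0 //; apply: le_trans (ler_normB _ _) _.
  apply: le_trans (lerD c2 c1) _.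
  by rewrite /eT le_eqVlt; apply/orP; left; apply/eqP; field.
exists (Y p); split=> //.
have Kt := TK (KY p).
pose D t := T (Y p) t - Y p t.
have step (i : 'I_n) : `|D (nd i.+1) - D (nd i)| <= h * (a + b) * eps.
  have pn : Y p (nd i.+1) - Y p (nd i) = slope p i * h by apply: polygon_node.
  have -> : D (nd i.+1) - D (nd i) = h * (a + b) * (G p i - (p i)%:R / N%:R).
    have -> : D (nd i.+1) - D (nd i) = (T (Y p) (nd i.+1) - T (Y p) (nd i)) -
      (Y p (nd i.+1) - Y p (nd i)) by rewrite /D; ring.
    by rewrite pn /G /slope; field; rewrite !gt_eqF.
  rewrite normrM gtr0_norm ?mulr_gt0 // ler_pM2l ?mulr_gt0 //.
  by apply: le_trans (hp i) _; lra.
have Dt0 t : t <= t0 -> D t = 0.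
  by move=> tt0; rewrite /D (sc_init Kt tt0) (sc_init (KY p) tt0) subrr.
have Dnode j : (j <= n)%N -> `|D (nd j)| <= j%:R * (h * (a + b) * eps).
  elim: j => [_|j IH jn].
    by rewrite Dt0 ?normr0 ?mul0r // /nd /node mul0r addr0.
  have := step (Ordinal jn) => /= s.
  have -> : D (nd j.+1) = (D (nd j.+1) - D (nd j)) + D (nd j) by ring.
  apply: le_trans (ler_normD _ _) _.
  rewrite -natr1 mulrDl mul1r addrC; apply: lerD => //.
  exact/IH/ltnW.
have Dnode' j : (j <= n)%N -> `|D (nd j)| <= e / 2.
  move=> jn; apply: le_trans (Dnode _ jn) _; rewrite -epsL.
  apply: le_trans (_ : n%:R * (h * (a + b) * eps) <= _).
    by rewrite ler_pM2r ?ler_nat // !mulr_gt0.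
  by rewrite -nh le_eqVlt; apply/orP; left; apply/eqP; ring.
have main t : t0 <= t <= t0 + L -> `|D t| <= e.
  move=> /andP[tt0 tt1].
  have q0 : 0 <= (t - t0) / h by rewrite divr_ge0 ?subr_ge0 // ltW.
  have [h1 h2] := andP (truncn_itv q0).
  pose j := Num.truncn ((t - t0) / h).
  rewrite -/j in h1 h2.
  have jn : (j <= n)%N.
    rewrite -(@ler_nat R) (le_trans h1) // ler_pdivrMr // nh.
    by rewrite lerBlDl.
  have tj : `|t - nd j| <= h.
    move: h1 h2; rewrite ler_pdivlMr // ltr_pdivrMr //.
    rewrite -[j.+1%:R]natr1 mulrDl mul1r /nd /node => h1 h2.
    by rewrite ler_norml; apply/andP; split; lra.
  have lip w : K w -> `|w t - w (nd j)| <= e / 4.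
    move=> Kw; apply: le_trans (sc_lipschitz a0 b0 Kw (nd0 j) tt0) _.
    by apply: le_trans abh; rewrite ler_pM2l.
  have := Dnode' _ jn; have := lip _ Kt; have := lip _ (KY p).
  rewrite /D !ler_norml => /andP[? ?] /andP[? ?] /andP[? ?].
  by apply/andP; split; lra.
move=> t; rewrite -/(D t); have [tt0|/ltW tt0] := leP t t0.
  by rewrite Dt0 // normr0 ltW.
have [tt1|/ltW tt1] := leP t (t0 + L); first by apply: main; rewrite tt0.
rewrite /D (sc_final Kt tt1) (sc_final (KY p) tt1); apply: main.
by rewrite lexx andbT lerDl ltW.
Qed.

Lemma fixpoint_of_approx (y_ : nat -> R -> R) y : (forall j, K (y_ j)) -> K y ->
  (forall j t, `|y_ j t - y t| <= j.+1%:R^-1) ->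
  (forall j t, `|T (y_ j) t - y_ j t| <= j.+1%:R^-1) -> T y = y.
Proof.
move=> Ky_ Ky hy hT; apply/funext => t.
have c1 : T (y_ j) t @[j --> \oo] --> T y t by exact: Tcont.
have inv0 : (j.+1%:R^-1 : R) @[j --> \oo] --> 0 by exact: cvg_harmonic.
have c2 : T (y_ j) t @[j --> \oo] --> y t.
  apply/cvgrPdist_le => e e0.
  have e2 : 0 < e / 2 by rewrite divr_gt0.
  have /cvgr0Pnorm_le/(_ _ e2) := inv0; apply: filterS => j.
  rewrite ger0_norm ?invr_ge0 // => hj; rewrite distrC.
  have -> : T (y_ j) t - y t = (T (y_ j) t - y_ j t) + (y_ j t - y t) by ring.
  apply: le_trans (ler_normD _ _) _; have := hy j t; have := hT j t.
  by move=> h1 h2; rewrite (splitr e); apply: lerD; apply: le_trans hj.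
exact: cvg_unique c1 c2.
Qed.

(** Schauder's theorem for [slope_class]. *)
Lemma exists_fixpoint : exists y, K y /\ T y = y.
Proof.
have /choice[y_ hy_] : forall j : nat, exists y, K y /\
    forall t, `|T y t - y t| <= j.+1%:R^-1.
  by move=> j; apply: approx_fixpoint; rewrite invr_gt0.
have [|y [s [Ky js hy]]] := @slope_class_seq_compact R t0 L phi a b L0 a0 b0 y_.
  by move=> j; have [] := hy_ j.
exists y; split=> //; apply: (@fixpoint_of_approx (y_ \o s)) => //.
  by move=> j; have [] := hy_ (s j).
move=> j t; have [_ h] := hy_ (s j); apply: le_trans (h t) _.
by rewrite lef_pV2 ?posrE // ler_nat ltnS.
Qed.

(** The sets of members of a chain beyond a given one generate a filter, and by
    compactness this filter has a cluster point, which is again a fixed point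
    and bounds the chain.  The order is a parameter so that maximal and minimal
    fixed points are obtained alike. *)
Lemma exists_premaximal_fixpoint (le : (R -> R) -> (R -> R) -> Prop) :
  (forall x, le x x) -> (forall y x z, le x y -> le y z -> le x z) ->
  (forall x y, (forall e, 0 < e -> exists z, le x z /\
     forall t, `|z t - y t| <= e) -> le x y) ->
  exists y, [/\ K y, T y = y &
    forall z, K z -> T z = z -> le y z -> le z y].
Proof.
move=> le_refl le_trans' le_closed.
pose F := {y : R -> R | K y /\ T y = y}.
have [y1 hy1] := exists_fixpoint.
pose f1 : F := exist _ y1 hy1.
pose rel : F -> F -> bool := fun f g => `[< le (sval f) (sval g) >].
have [| | |[y [Ky Ty]] ymax] := @ZL_preorder F f1 rel.
- by move=> f; apply/asboolP.
- move=> f g h /asboolP fg /asboolP gh; apply/asboolP; exact: le_trans' fg gh.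
- move=> A totA; have [[g0 Ag0]|A0] := pselect (A !=set0); last first.
    by exists f1 => s As; case: A0; exists s.
  pose B (g : F) := [set sval f | f in [set f | A f /\ le (sval g) (sval f)]].
  pose Fl := filter_from A B.
  have PF : ProperFilter Fl.
    apply: filter_from_proper.
      apply: filter_from_filter; first by exists g0.
      move=> f g Af Ag; have [fg|gf] := totA _ _ Af Ag.
        exists g => // _ [k [Ak gk] <-]; split; exists k => //; split=> //.
        by apply: le_trans' gk; apply/asboolP.
      exists f => // _ [k [Ak gk] <-]; split; exists k => //; split=> //.
      by apply: le_trans' gk; apply/asboolP.
    by move=> g Ag; exists (sval g); exists g.
  have FK : Fl K by exists g0 => // _ [[k [Kk ?]] _ <-].
  have [y [Ky hy]] := slope_class_compact L0 a0 b0 PF FK.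
  have /choice[y_ hy_] : forall j : nat, exists z, [/\ T z = z, K z &
      forall t, `|z t - y t| <= j.+1%:R^-1].
    move=> j; have [||z [[[k [Kk Tk]] _ <-] Kz hz]] := hy (B g0) j.+1%:R^-1.
    - by exists g0.
    - by rewrite invr_gt0.
    by exists k.
  have Ty : T y = y.
    apply: (@fixpoint_of_approx y_) => // j; have [Tz Kz hz] := hy_ j => //.
    by move=> t; rewrite Tz subrr normr0 invr_ge0.
  exists (exist _ y (conj Ky Ty)) => g Ag; apply/asboolP => /=.
  apply: le_closed => e e0.
  have [||z [[k [Ak gk] <-] _ hz]] := hy (B g) e => //; first by exists g.
  by exists (sval k).
exists y; split=> // z Kz Tz yz.
have := ymax (exist _ z (conj Kz Tz)) => /(_ _)/asboolP; apply.
exact/asboolP.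
Qed.

End FixedPoints.

(** * Absolutely continuous functions with zero derivative *)

Section RealInduction.
Variable R : realType.

(** Continuous induction: the supremum of the points [t] in [[p, q]] with [P t]
    can only be [q].  It replaces the choice of a fine tagged partition. *)
Lemma real_induction (P : R -> Prop) (p q : R) : p <= q -> P p ->
  (forall c, p <= c <= q -> exists2 d, 0 < d & forall u v,
     p <= u -> u <= c -> c <= v -> v <= q -> c - d < u -> v < c + d ->
     P u -> P v) ->
  P q.
Proof.
move=> pq Pp step; pose A := [set t | p <= t <= q /\ P t].
have Ap : A p by rewrite /A /= lexx pq.
have hA : has_sup A by split; [exists p|exists q => t [/andP[]]].
pose c := sup A.
have pc : p <= c by apply: ub_le_sup => //; case: hA.
have cq : c <= q by apply: ge_sup; [exists p|move=> t [/andP[]]].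
have [|d d0 hd] := step c; first by rewrite pc cq.
have [u [/andP[pu uq] Pu] cu] := sup_adherent d0 hA.
have uc : u <= c by apply: ub_le_sup; [case: hA|split; rewrite ?pu].
pose v := Num.min q (c + d / 2).
have d2 : 0 < d / 2 by rewrite divr_gt0.
have cv : c <= v by rewrite le_min cq /= lerDl ltW.
have vq : v <= q by rewrite ge_min lexx.
have vd : v < c + d.
  by rewrite gt_min; apply/orP; right; rewrite ltrD2l; lra.
have Pv : P v by apply: (hd u v).
have vc : v <= c.
  by apply: ub_le_sup; [case: hA|split; rewrite ?(le_trans pc cv)].
by move: vc Pv; rewrite /v; case: (leP q (c + d / 2)) => // _ ? _; exfalso; lra.
Qed.

Local Notation mu := (@lebesgue_measure R).

Lemma small_increment_of_zero_derivative (x : R -> R) (c e : R) :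
  0 < e -> derivable x c 1 -> derive1 x c = 0 ->
  exists2 d, 0 < d & forall u, `|u - c| < d -> `|x u - x c| <= e * `|u - c|.
Proof.
move=> e0 dx dx0.
have : h^-1 *: (x (h + c) - x c) @[h --> 0^'] --> (derive1 x c : R).
  have /cvg_ex [l hl] := dx.
  rewrite derive1E /derive (cvg_lim _ hl) //.
  have E : (fun h : R => h^-1 *: (x (h + c) - x c)) =
     (fun h => h^-1 *: ((x \o shift c) (h *: 1) - x c)).
    by apply/funext => h; rewrite /= [h *: 1]mulr1.
  by rewrite E.
rewrite dx0 => /cvgr0Pnorm_le/(_ _ e0); rewrite near_withinE.
move/nbhs_ballP => [d /= d0 hd]; exists d => // u ud.
have [->|uc] := eqVneq u c; first by rewrite !subrr normr0 mulr0.
have uc0 : u - c != 0 by rewrite subr_eq0.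
have := hd (u - c); rewrite /ball /= sub0r normrN => /(_ ud uc0).
rewrite subrK normrZ normfV ler_pdivrMl ?normr_gt0 //.
by rewrite mulrC.
Qed.

(** Intervals inside [[p, t]] that are listed from right to left.  Carrying the
    bound on their total length along dispenses with adding up the measures of
    the members of a disjoint family afterwards. *)
Definition intervals_upto (U : set R) (p t : R) (s : seq (R * R)) : Prop :=
  [/\ forall i, i \in s -> [/\ p <= i.1, i.1 <= i.2 & i.2 <= t],
      pairwise (fun i j => j.2 <= i.1) s &
      ((\sum_(i <- s) (i.2 - i.1))%:E <= mu (U `&` `[p, t]))%E].

Lemma intervals_upto_cons (U : set R) (p u v : R) (s : seq (R * R)) :
  open U -> p <= u -> u <= v -> `[u, v] `<=` U ->
  intervals_upto U p u s -> intervals_upto U p v ((u, v) :: s).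
Proof.
move=> oU pu uv uvU [h1 h2 h3]; split.
- move=> i; rewrite inE => /predU1P[->|/h1[a b c]] //=.
  by split=> //; exact: le_trans uv.
- by rewrite /= h2 andbT; apply/allP => i /h1[].
- have mU : measurable U by exact: open_measurable.
  rewrite big_cons /= EFinD.
  have -> : (v - u)%:E = mu `]u, v].
    rewrite lebesgue_measure_itv /= lte_fin; case: ltP => [//|vu].
    have -> : u = v by apply/eqP; rewrite eq_le uv vu.
 by rewrite subrr.
  apply: (@le_trans _ _ (mu `]u, v] + mu (U `&` `[p, u]))%E).
    exact: leeD2l.
  rewrite -measureU //; last 2 first.
  - exact: measurableI.
  - rewrite -subset0 => t [] /=; rewrite !in_itv /= => /andP[ut _].
    by case=> _ /andP[_]; rewrite leNgt ut.
  apply: le_measure; rewrite ?inE.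
  - by apply: measurableU => //; exact: measurableI.
  - exact: measurableI.
  - move=> t [] /=; rewrite !in_itv /=.
      move=> /andP[ut tv]; split; first by apply: uvU; rewrite /= in_itv /= (ltW ut).
      by rewrite tv (le_trans pu (ltW ut)).
    by move=> [Ut /andP[-> tu]]; split=> //; rewrite (le_trans tu uv).
Qed.

(** Cover the exceptional null set by an open set [U] of small measure.  Moving
    from left to right, the increment of [x] across a short interval is
    controlled by the derivative if the interval contains a suitable point off
    the null set; otherwise the interval can be taken inside [U], and absolute
    continuity bounds the sum of the increments over all these intervals. *)
Lemma abs_cont_zero_derivative (x : R -> R) (p q : R) : p <= q ->
  abs_cont_on `[p, q] x ->
  {ae mu, forall t, `[p, q]%classic t -> derivable x t 1 /\ derive1 x t = 0} ->
  x q = x p.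
Proof.
move=> pq acx [N [mN N0 hN]].
apply/eqP; rewrite -subr_eq0 -normr_le0; apply/ler_addgt0Pl => e0 e0_gt0.
rewrite addr0.
(* The error is [e] per unit of length plus [e] for the intervals inside [U]. *)
pose e := e0 / (q - p + 1).
have qp1 : 0 < q - p + 1 by rewrite ltr_wpDl // subr_ge0.
have e_gt0 : 0 < e by rewrite divr_gt0.
have [d d0 hd] := acx _ e_gt0.
have [|U [oU NU hU]] := lebesgue_regularity_outer mN _ d0.
  by apply: (@le_lt_trans _ _ 0%E); [rewrite -N0|exact: ltry].
have mU : measurable U by exact: open_measurable.
have muU : (mu U < d%:E)%E.
  have -> : U = N `|` (U `\` N) by rewrite setDUK.
  apply: le_lt_trans hU; apply: le_trans (measureU2 _ _ _) _ => //.
    exact: measurableD.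
  by rewrite -[leRHS]add0e; apply: leeD => //; rewrite -N0.
pose P t := exists s, intervals_upto U p t s /\
  `|x t - x p| <= e * (t - p) + \sum_(i <- s) `|x i.2 - x i.1|.
suff : P q.
  move=> [s [[s1 s2 s3] hs]].
  have sd : \sum_(i <- s) (i.2 - i.1) < d.
    rewrite -lte_fin; apply: le_lt_trans s3 _; apply: le_lt_trans muU.
    by apply: le_measure; rewrite ?inE //; exact: measurableI.
  have ss (F : R * R -> R) :
      \sum_(i <- s) F i = \sum_(i < size s) F (nth (0, 0) s i).
    by rewrite (big_nth (0, 0)) big_mkord.
  rewrite !ss in sd hs.
  have := hd (size s) (fun i => (nth (0, 0) s i).1) (fun i => (nth (0, 0) s i).2).
  move=> /(_ _ _ sd) hlt.
  have {}hlt : \sum_(i < size s) `|x (nth (0, 0) s i).2 - x (nth (0, 0) s i).1| < e.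
    apply: hlt => [i|].
      have [h1 h2 h3] := s1 _ (mem_nth (0, 0) (ltn_ord i)).
      by rewrite /= !in_itv /= h1 h3 (le_trans h2 h3) (le_trans h1 h2).
    apply/trivIsetP => i j _ _ ij; rewrite -subset0 => t [] /=.
    rewrite !in_itv /= => /andP[h1 h2] /andP[h3 h4].
    have pw := pairwiseP (0, 0) s2.
    have [ltij|ltji] : (i < j)%N \/ (j < i)%N.
      by apply/orP; rewrite -neq_ltn.
    + have := pw i j; rewrite !inE !ltn_ord => /(_ isT isT ltij) h.
      by have := lt_trans (le_lt_trans h h1) h4; rewrite ltxx.
    + have := pw j i; rewrite !inE !ltn_ord => /(_ isT isT ltji) h.
      by have := lt_trans (le_lt_trans h h3) h2; rewrite ltxx.
  apply: le_trans hs _; apply: (@le_trans _ _ (e * (q - p) + e)).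
    by rewrite lerD2l ltW.
  by rewrite -{2}[e]mulr1 -mulrDr /e divfK ?gt_eqF.
apply: (@real_induction P p q) => //.
  exists [::]; split; last by rewrite !subrr normr0 mulr0 big_nil addr0.
  by split=> //; rewrite big_nil.
move=> c pcq; have [cN|cN] := pselect (N c).
  have /nbhs_ballP[r /= r0 hr] : nbhs c U by apply: open_nbhs_nbhs; split=> //; exact: NU.
  exists r => // u v pu uc cv vq cru vcr [s [hs hx]].
  have uv := le_trans uc cv.
  exists ((u, v) :: s); split.
    apply: intervals_upto_cons => // t; rewrite /= in_itv /= => /andP[ut tv].
    by apply: hr; rewrite /ball /= ltr_norml; apply/andP; split; lra.
  rewrite big_cons /=.
  have -> : x v - x p = (x v - x u) + (x u - x p) by ring.
  apply: le_trans (ler_normD _ _) _.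
  have : e * (u - p) <= e * (v - p) by rewrite ler_pM2l // lerD2r.
  by lra.
have [dc dc0] : derivable x c 1 /\ derive1 x c = 0.
  by apply: contrapT => h; apply: cN; apply: hN => /= /(_ pcq).
have [r r0 hr] := small_increment_of_zero_derivative e_gt0 dc dc0.
exists r => // u v pu uc cv vq cru vcr [s [[s1 s2 s3] hx]].
have uv := le_trans uc cv.
exists s; split.
  split=> //.
    by move=> i /s1[? ? ?]; split=> //; exact: le_trans uv.
  apply: le_trans s3 _; apply: le_measure; rewrite ?inE; try exact: measurableI.
  by apply: setIS => t /=; rewrite !in_itv /= => /andP[-> /le_trans]; exact.
have hu : `|x u - x c| <= e * (c - u).
  have := hr u; rewrite distrC ger0_norm ?subr_ge0 //; apply.
  by lra.
have hv : `|x v - x c| <= e * (v - c).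
  have := hr v; rewrite [X in _ * X]ger0_norm ?subr_ge0 //; apply.
  by rewrite ger0_norm ?subr_ge0 //; lra.
have -> : x v - x p = (x v - x c) - (x u - x c) + (x u - x p) by ring.
apply: le_trans (ler_normD _ _) _.
apply: le_trans (lerD (ler_normB _ _) (lexx _)) _.
have -> : e * (v - p) = e * (v - c) + e * (c - u) + e * (u - p) by ring.
by lra.
Qed.

End RealInduction.

(** * Lebesgue measurable functions and primitives *)

Section Measure.
Variable R : realType.
Local Notation mu := (@lebesgue_measure R).

(** Each of the countably many sets on which [g] exceeds a rational is Borel up
    to a null set; [N] is the union of these null sets. *)
Lemma lebesgue_measurable_borel_off_null (D : set R) (g : R -> R) :
  measurable D -> lebesgue_measurable_fun D g ->
  exists N : set R, [/\ measurable N, mu N = 0%E & measurable_fun (D `\` N) g].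
Proof.
move=> mD mg.
have mDc : (completed_algebra_gen mu).-sigma.-measurable D.
  rewrite g_sigma_completed_algebra_genE; exists D => //.
  by exists set0; [exact: negligible_set0|rewrite setU0].
have /choice[AN hAN] : forall q : rat, exists AN : set R * set R,
    [/\ measurable AN.1, measurable AN.2, mu AN.2 = 0%E, AN.1 `<=` D &
      forall t, D t -> ~ AN.2 t -> (ratr q < g t <-> AN.1 t)].
  move=> q.
  have : (completed_algebra_gen mu).-sigma.-measurable
      (D `&` g @^-1` `]ratr q, +oo[%classic).
    by apply: (mg mDc); exact: measurable_itv.
  rewrite g_sigma_completed_algebra_genE.
  move=> [A mA [N [M [mM M0 NM]] E]].
  have {}E t : A t \/ N t <-> D t /\ ratr q < g t.
    have -> : (A t \/ N t) = (D `&` g @^-1` `]ratr q, +oo[%classic) t.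
      by rewrite -E.
    by rewrite /= in_itv /= andbT.
  exists (A, M); split => //=; first by move=> t At; have [] := (E t).1 (or_introl At).
  move=> t Dt Mt; split=> [gt|At]; last by have [] := (E t).1 (or_introl At).
  by have [|//|/NM] := (E t).2.
pose M n := if unpickle n is Some q then (AN q).2 else set0.
pose N := \bigcup_n M n.
have mM n : measurable (M n).
  by rewrite /M; case: unpickle => // q; have [] := hAN q.
have mN : measurable N by exact: bigcup_measurable.
have N0 : mu N = 0%E.
  apply: measure_negligible => //; apply: negligible_bigcup => n.
  rewrite /M; case: unpickle => [q|]; last exact: negligible_set0.
  by apply/negligibleP; have [] := hAN q.
have MN q t : (AN q).2 t -> N t by move=> h; exists (pickle q); [by []|by rewrite /M pickleK].
exists N; split=> //.
apply: (measurability _ (RGenOInfty.measurableE R)).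
move=> _ [_ [r ->] <-].
have -> : (D `\` N) `&` g @^-1` `]r, +oo[%classic =
    (\bigcup_q (if r < ratr q then (AN q).1 else set0)) `\` N.
  apply/seteqP; split=> t /=.
    rewrite in_itv /= andbT => -[[Dt Nt] rt]; split=> //.
    have [q] := rat_in_itvoo rt; rewrite in_itv /= => /andP[rq qt]; exists q => //.
    have [_ _ _ _ /(_ t Dt) h] := hAN q.
    by rewrite rq; apply/h => // /MN.
  move=> [[q _]]; case: ifP => // rq At Nt; rewrite in_itv /= andbT.
  have [_ _ _ AD h] := hAN q; have Dt := AD _ At; split=> //.
  by apply: (lt_trans rq); apply/h => // /MN.
apply: measurableD => //; apply: bigcupT_measurable_rat => q.
by case: ifP => // _; have [] := hAN q.
Qed.

Lemma lebesgue_measure_bounded_itv (l r : bool) (s t : R) :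
  (mu [set` Interval (BSide l s) (BSide r t)] < +oo)%E.
Proof.
rewrite lebesgue_measure_itv /=; case: ifP => _; last exact: ltry.
by rewrite -EFinB ltry.
Qed.

Lemma lebesgue_aeS (P Q : R -> Prop) : (forall t, P t -> Q t) ->
  {ae mu, forall t, P t} -> {ae mu, forall t, Q t}.
Proof.
by move=> PQ; apply: filterS => //; exact: (ae_filter_ringOfSetsType mu).
Qed.

Lemma lebesgue_aeI (P Q : R -> Prop) : {ae mu, forall t, P t} ->
  {ae mu, forall t, Q t} -> {ae mu, forall t, P t /\ Q t}.
Proof.
by move=> hP hQ; apply: (@filterI _ (almost_everywhere mu)).
Qed.

Section Primitive.
Variables (g : R -> R) (a b : R).
Hypotheses (mg : measurable_fun setT g) (gab : forall t, - a <= g t <= b).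

Lemma bounded_integrable_itv (A : set R) (s t : R) : measurable A ->
  A `<=` `[s, t] -> mu.-integrable A (EFin \o g).
Proof.
move=> mA Ast; apply: (@integrableS _ _ _ mu `[s, t]) => //.
apply: measurable_bounded_integrable => //.
- exact: lebesgue_measure_bounded_itv.
- exact: measurable_funTS.
- exists (Num.max a b); split; first exact: num_real.
  move=> M hM z _; have := gab z; move: hM; rewrite gt_max => /andP[aM bM].
  by move=> /andP[? ?]; rewrite /= ler_norml; apply/andP; split; lra.
Qed.

Definition primitive (t0 t : R) : R := \int[mu]_(s in `[t0, t]) g s.

Lemma primitive0 t0 : primitive t0 t0 = 0.
Proof. by rewrite /primitive set_itv1 Rintegral_set1. Qed.

Lemma primitive_sub t0 s t : t0 <= s -> s <= t ->
  primitive t0 t - primitive t0 s = \int[mu]_(u in `]s, t]) g u.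
Proof.
move=> hs st; apply: Rintegral_itvB; rewrite ?bnd_simp //.
by apply: (@bounded_integrable_itv _ t0 t).
Qed.

Lemma primitive_slope t0 s t : t0 <= s -> s <= t ->
  - a * (t - s) <= primitive t0 t - primitive t0 s <= b * (t - s).
Proof.
move=> hs st; rewrite primitive_sub //.
have mst : fine (mu `]s, t]%classic) = t - s.
  rewrite lebesgue_measure_itv /= lte_fin; case: ltP => [//|ts].
  have -> : s = t by apply/eqP; rewrite eq_le st ts.
  by rewrite subrr.
have ic (r : R) : mu.-integrable `]s, t] (EFin \o cst r).
  apply: measurable_bounded_integrable => //.
  - exact: lebesgue_measure_bounded_itv.
  - exact: bounded_cst.
have ig : mu.-integrable `]s, t] (EFin \o g).
  by apply: (@bounded_integrable_itv _ s t) => //; exact: subset_itv_oc_cc.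
rewrite -mst -!Rintegral_cst //; apply/andP; split.
- by apply: le_Rintegral => //; [exact: (ic (- a))|move=> u _; case/andP: (gab u)].
- by apply: le_Rintegral => //; [exact: (ic b)|move=> u _; case/andP: (gab u)].
Qed.

Lemma primitive_final t0 t1 t : t0 <= t1 -> t1 <= t ->
  (forall s, t1 < s -> g s = 0) -> primitive t0 t = primitive t0 t1.
Proof.
move=> h1 h2 g0; apply/eqP; rewrite -subr_eq0 primitive_sub //; apply/eqP.
transitivity (\int[mu]_(u in `]t1, t]) (0 : R)); last first.
  by rewrite Rintegral_cst // mul0r.
by apply: eq_Rintegral => u; rewrite inE /= in_itv /= => /andP[/g0].
Qed.

Lemma primitive_derivable t0 : {ae mu, forall t, t0 < t ->
  derivable (primitive t0) t 1 /\ derive1 (primitive t0) t = g t}.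
Proof.
have loc : locally_integrable setT g.
  split; [exact: mg|exact: openT|move=> K _ cK].
  have mK : measurable K by exact: compact_measurable.
  have [M [_ hM]] := compact_bounded cK.
  have : mu.-integrable K (EFin \o g).
    apply: (@bounded_integrable_itv _ (- (`|M| + 1)) (`|M| + 1)) => // t Kt.
    rewrite /= in_itv /= -ler_norml; apply: hM => //.
    by rewrite (le_lt_trans (ler_norm M)) // ltrDl.
  by case/integrableP.
have := lebesgue_differentiation loc; apply: lebesgue_aeS => t lt t0t.
apply: (@FTC1_lebesgue_pt R g (BLeft t0) t (t + 1)); rewrite ?ltrDl ?bnd_simp //.
by apply: (@bounded_integrable_itv _ t0 (t + 1)).
Qed.

End Primitive.

Lemma primitive_cvg (g_ : nat -> R -> R) (g : R -> R) (a b t0 t : R) :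
  (forall j, measurable_fun setT (g_ j)) -> measurable_fun setT g ->
  (forall j s, - a <= g_ j s <= b) ->
  {ae mu, forall s, `[t0, t]%classic s -> g_ j s @[j --> \oo] --> g s} ->
  primitive (g_ j) t0 t @[j --> \oo] --> primitive g t0 t.
Proof.
move=> mg_ mg gab ae_cvg.
pose M := Num.max a b.
have gM j s : `|g_ j s| <= M.
  have /andP[h1 h2] := gab j s; rewrite ler_norml.
  have : a <= M by rewrite le_max lexx.
  have : b <= M by rewrite le_max lexx orbT.
  by move=> *; apply/andP; split; lra.
have [|||| |ig _ cv] := @dominated_convergence _ _ R mu `[t0, t]%classic
  (measurable_itv _) (fun j => EFin \o g_ j) (EFin \o g) (EFin \o cst M).
- by move=> j; apply/measurable_EFinP; exact: measurable_funTS (mg_ j).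
- by apply/measurable_EFinP; exact: measurable_funTS.
- apply: lebesgue_aeS ae_cvg => s hs /hs h.
  by apply: cvg_EFin; [exact: nearW|exact: h].
- apply: measurable_bounded_integrable => //.
  - exact: lebesgue_measure_bounded_itv.
  - exact: bounded_cst.
- by apply: aeW => s j _; rewrite /= lee_fin.
apply: fine_cvg; rewrite fineK; first exact: cv.
exact: integrable_fin_num.
Qed.

End Measure.

(** * Elementary real analysis *)

Section Elementary.
Variable R : realType.

Lemma within_continuousP (J : set R) (y : R -> R) :
  {within J, continuous y} <-> forall t, J t -> forall e, 0 < e ->
    exists2 d, 0 < d & forall s, J s -> `|s - t| < d -> `|y s - y t| < e.
Proof.
rewrite subspace_continuousP; split=> h t Jt.
  move=> e e0; have /cvgrPdist_lt/(_ _ e0) := h t Jt.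
  rewrite near_withinE => /nbhs_ballP[d /= d0 hd]; exists d => // s Js sd.
  by rewrite distrC; apply: hd => //; rewrite /ball /= distrC.
apply/cvgrPdist_lt => e e0; have [d d0 hd] := h t Jt e e0.
rewrite near_withinE; apply/nbhs_ballP; exists d => // s sd Js.
by rewrite distrC; apply: hd => //; rewrite distrC.
Qed.

Definition lipschitz_on (J : set R) (C : R) (y : R -> R) : Prop :=
  forall s t, J s -> J t -> `|y t - y s| <= C * `|t - s|.

Lemma lipschitz_contC (J : set R) C y : 0 < C -> lipschitz_on J C y -> contC J y.
Proof.
move=> C0 ly; apply/within_continuousP => t Jt e e0.
exists (e / C); first by rewrite divr_gt0.
move=> s Js st; apply: le_lt_trans (ly t s Jt Js) _.
by rewrite mulrC -ltr_pdivlMr.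
Qed.

Lemma lipschitz_abs_cont (J : set R) C y : 0 < C -> lipschitz_on J C y ->
  abs_cont_on J y.
Proof.
move=> C0 ly e e0; exists (e / C); first by rewrite divr_gt0.
move=> n a b hab _ hsum.
apply: le_lt_trans (_ : C * \sum_(i < n) (b i - a i) < e); last first.
  by rewrite mulrC -ltr_pdivlMr.
rewrite mulr_sumr; apply: ler_sum => i _; have [Ja Jb ab] := hab i.
by apply: le_trans (ly _ _ Ja Jb) _; rewrite ger0_norm // subr_ge0.
Qed.

Lemma abs_contB (J : set R) (x y : R -> R) : abs_cont_on J x ->
  abs_cont_on J y -> abs_cont_on J (fun t => x t - y t).
Proof.
move=> ax ay e e0; have e2 : 0 < e / 2 by rewrite divr_gt0.
have [d1 d10 h1] := ax _ e2; have [d2 d20 h2] := ay _ e2.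
exists (Num.min d1 d2); first by rewrite lt_min d10.
move=> n a b hab tI; rewrite lt_min => /andP[s1 s2].
have := h1 n a b hab tI s1; have := h2 n a b hab tI s2.
move=> H2 H1; rewrite (splitr e); apply: le_lt_trans (ltrD H1 H2).
rewrite -big_split /=; apply: ler_sum => i _.
have -> : x (b i) - y (b i) - (x (a i) - y (a i)) =
  (x (b i) - x (a i)) - (y (b i) - y (a i)) by ring.
exact: ler_normB.
Qed.

Lemma derive1_sub (x y : R -> R) c : derivable x c 1 -> derivable y c 1 ->
  derivable (fun t => x t - y t) c 1 /\
  derive1 (fun t => x t - y t) c = derive1 x c - derive1 y c.
Proof.
move=> dx dy; split; first exact: derivableB.
rewrite !derive1E; exact: deriveB.
Qed.

Lemma derivable_local_eq (x y : R -> R) c d : 0 < d ->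
  (forall u, `|u - c| < d -> x u = y u) -> derivable y c 1 ->
  derivable x c 1 /\ derive1 x c = derive1 y c.
Proof.
move=> d0 xy dy; have /cvg_ex[l hl] := dy.
have hx : h^-1 *: ((x \o shift c) (h *: 1) - x c) @[h --> (0 : R)^'] --> (l : R).
  apply: cvg_trans hl; apply: near_eq_cvg; rewrite near_withinE.
  apply/nbhs_ballP; exists d => // h; rewrite /ball /= sub0r normrN => hd _.
  rewrite -!xy ?subrr ?normr0 // addrK.
  by rewrite [h *: 1]mulr1.
split; first by apply/cvg_ex; exists l.
rewrite !derive1E /derive (cvg_lim (@Rhausdorff R) hx).
by rewrite (cvg_lim (@Rhausdorff R) hl).
Qed.

Lemma set_min_image (f : R -> R) (x y : R) : x <= y ->
  {within `[x, y], continuous f} ->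
  exists c, [/\ `[x, y]%classic c, set_min (f @` `[x, y]) = f c &
    forall t, `[x, y]%classic t -> f c <= f t].
Proof.
move=> xy cf; have [c cxy hc] := EVT_min xy cf.
have := @xgetPex _ 0 [set m | (f @` `[x, y]) m /\ lbound (f @` `[x, y]) m].
case; first by exists (f c); split=> [|_ [t txy <-]]; [exists c|exact: hc].
rewrite -/(set_min _) => -[d dxy <-] lb; exists d; split=> // t txy.
by apply: lb; exists t.
Qed.

Lemma set_max_image (f : R -> R) (x y : R) : x <= y ->
  {within `[x, y], continuous f} ->
  exists c, [/\ `[x, y]%classic c, set_max (f @` `[x, y]) = f c &
    forall t, `[x, y]%classic t -> f t <= f c].
Proof.
move=> xy cf; have [c cxy hc] := EVT_max xy cf.
have := @xgetPex _ 0 [set m | (f @` `[x, y]) m /\ ubound (f @` `[x, y]) m].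
case; first by exists (f c); split=> [|_ [t txy <-]]; [exists c|exact: hc].
rewrite -/(set_max _) => -[d dxy <-] ub; exists d; split=> // t txy.
by apply: ub; exists t.
Qed.

(** For [y > B] one has [f y <= c * (v + m * L)], which is at most [m] when
    [m >= c * |v| / (1 - c * L)]; here [c * L < 1] matters.  To the left of [B]
    the function is bounded above independently of [m]. *)
Lemma sublinear_bound (L v : R) (f : R -> R) (c A B : R) : 0 < L ->
  continuous f -> 0 <= c -> c < 1 / L -> (forall y, y < A -> f y <= 0) ->
  (forall y, B < y -> f y <= c * y) ->
  exists2 m, 0 < m & forall y, y <= v + m * L -> f y <= m.
Proof.
move=> L0 cf c0 cL fA fB.
have [M hM] : exists M, 0 <= M /\ forall y, A <= y -> y <= B -> f y <= M.
  have [AB|BA] := leP A B; last first.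
    by exists 0; split=> // y h1 h2; have := lt_le_trans BA h1; rewrite ltNge h2.
  have [z _ hz] := EVT_max AB (continuous_subspaceT cf).
  exists `|f z|; split=> // y h1 h2; apply: le_trans (ler_norm _).
  by apply: hz; rewrite in_itv /= h1.
have cL1 : 0 < 1 - c * L by move: cL; rewrite ltr_pdivlMr // subr_gt0.
pose m := M + c * `|v| / (1 - c * L) + 1.
have q0 : 0 <= c * `|v| / (1 - c * L).
  by rewrite divr_ge0 ?mulr_ge0 // ltW.
have [M0 hM'] := hM.
have m0 : 0 < m by rewrite /m; lra.
exists m => // y ym; have [yA|Ay] := ltP y A; first by have := fA _ yA; lra.
have [yB|By] := leP y B; first by have := hM' _ Ay yB; rewrite /m; lra.
apply: le_trans (fB _ By) _.
apply: le_trans (_ : c * (`|v| + m * L) <= _).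
  by apply: ler_wpM2l => //; apply: le_trans ym _; rewrite lerD2r ler_norm.
have : c * `|v| <= m * (1 - c * L).
  by rewrite -ler_pdivrMr // /m; lra.
by lra.
Qed.

End Elementary.

(** * The lower and the upper solution *)

Section Envelopes.
Variables (R : realType) (t0 L r : R) (k : R -> R).
Hypotheses (L0 : 0 < L) (r0 : 0 <= r) (ck : contC (I_minus t0 r) k).
Local Notation mu := (@lebesgue_measure R).
Local Notation lo := (set_min (k @` I_minus t0 r)).
Local Notation hi := (set_max (k @` I_minus t0 r)).

Lemma set_min_init_le t : I_minus t0 r t -> lo <= k t.
Proof.
have [|c [_ -> h]] := set_min_image _ ck; last exact: h.
by rewrite lerBlDr lerDl.
Qed.

Lemma set_max_init_ge t : I_minus t0 r t -> k t <= hi.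
Proof.
have [|c [_ -> h]] := set_max_image _ ck; last exact: h.
by rewrite lerBlDr lerDl.
Qed.

Lemma init_t0 : I_minus t0 r t0.
Proof. by rewrite /I_minus /= in_itv /= lexx lerBlDr lerDl r0. Qed.

Lemma I_allE t : I_all t0 L r t <-> t0 - r <= t <= t0 + L.
Proof.
rewrite /I_all /I_minus /I_zero; split=> [[]|] /=; rewrite ?in_itv /=.
- by move=> /andP[-> h] /=; apply: le_trans h _; rewrite lerDl ltW.
- by move=> /andP[h ->]; rewrite andbT; apply: le_trans h; rewrite lerBlDr lerDl.
- move=> /andP[h1 h2]; have [tt0|/ltW tt0] := leP t t0.
    by left; rewrite h1.
  by right; rewrite tt0.

Qed.

(** This form shows at once that the two pieces fit together at [t0] and that the
    function is Lipschitz. *)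
Lemma lower_funE m t : lower_fun t0 r k m t = lo - m * Num.max 0 (t - t0).
Proof.
rewrite /lower_fun; case: ltP => h.
  by rewrite (max_idPl _) ?mulr0 ?subr0 // subr_le0 ltW.
rewrite (max_idPr _) ?subr_ge0 //; ring.
Qed.

Lemma upper_funE m t : upper_fun t0 r k m t = hi + m * Num.max 0 (t - t0).
Proof.
rewrite /upper_fun; case: ltP => h.
  by rewrite (max_idPl _) ?mulr0 ?addr0 // subr_le0 ltW.
rewrite (max_idPr _) ?subr_ge0 //; ring.
Qed.

Lemma max0_lipschitz (s t : R) :
  `|Num.max 0 (t - t0) - Num.max 0 (s - t0)| <= `|t - s|.
Proof.
case: (leP 0 (t - t0)); case: (leP 0 (s - t0)); case: (ler0P (t - s)) => *;
  by rewrite ler_norml; apply/andP; split; lra.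
Qed.

Lemma lower_lipschitz J m : 0 < m -> lipschitz_on J m (lower_fun t0 r k m).
Proof.
move=> m0 s t _ _; rewrite !lower_funE.
rewrite (_ : _ - _ = m * (Num.max 0 (s - t0) - Num.max 0 (t - t0))); last by ring.
rewrite normrM gtr0_norm // ler_pM2l //.
by rewrite distrC; exact: max0_lipschitz.
Qed.

Lemma upper_lipschitz J m : 0 < m -> lipschitz_on J m (upper_fun t0 r k m).
Proof.
move=> m0 s t _ _; rewrite !upper_funE opprD addrACA subrr add0r -mulrBr.
by rewrite normrM gtr0_norm // ler_pM2l // max0_lipschitz.
Qed.

Lemma max0_range t : I_all t0 L r t -> 0 <= Num.max 0 (t - t0) <= L.
Proof.
move=> /I_allE /andP[_ h]; rewrite le_max lexx /= ge_max (ltW L0) /=.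
by rewrite lerBlDl.
Qed.

Lemma lower_ge m t : 0 < m -> I_all t0 L r t ->
  lo - m * L <= lower_fun t0 r k m t.
Proof.
move=> m0 /max0_range /andP[_ h].
by rewrite lower_funE lerD2l lerN2 ler_pM2l.
Qed.

Lemma upper_le m t : 0 < m -> I_all t0 L r t ->
  upper_fun t0 r k m t <= hi + m * L.
Proof.
move=> m0 /max0_range /andP[_ h].
by rewrite upper_funE lerD2l ler_pM2l.
Qed.

Lemma lower_le_upper m mbar t : 0 < m -> 0 < mbar -> I_all t0 L r t ->
  lower_fun t0 r k m t <= upper_fun t0 r k mbar t.
Proof.
move=> m0 mbar0 /max0_range /andP[h _]; rewrite lower_funE upper_funE.
have := le_trans (set_min_init_le init_t0) (set_max_init_ge init_t0).
have : 0 <= m * Num.max 0 (t - t0) by rewrite mulr_ge0 // ltW.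
have : 0 <= mbar * Num.max 0 (t - t0) by rewrite mulr_ge0 // ltW.
by lra.
Qed.

Lemma affine_derivable (A B t : R) :
  derivable (fun u : R => A + B * (u - t0)) t 1 /\
  derive1 (fun u : R => A + B * (u - t0)) t = B.
Proof.
have d : is_derive t (1 : R) (fun u : R => A + B * (u - t0)) B.
  apply: is_derive_eq.
  by rewrite add0r mul1r subr0 [B *: 1]mulr1.
by split; [apply: ex_derive|rewrite derive1E derive_val].
Qed.

Lemma lower_derivable m t : t0 < t ->
  derivable (lower_fun t0 r k m) t 1 /\ derive1 (lower_fun t0 r k m) t = - m.
Proof.
move=> tt0; have [da dv] := affine_derivable lo (- m) t.
have [|u ut|d e] := derivable_local_eq _ _ da (d := t - t0)
    (x := lower_fun t0 r k m); rewrite ?subr_gt0 //.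
  rewrite lower_funE (max_idPr _) ?mulNr //.
  by move: ut; rewrite ltr_norml => /andP[]; lra.
by rewrite e dv.
Qed.

Lemma upper_derivable m t : t0 < t ->
  derivable (upper_fun t0 r k m) t 1 /\ derive1 (upper_fun t0 r k m) t = m.
Proof.
move=> tt0; have [da dv] := affine_derivable hi m t.
have [|u ut|d e] := derivable_local_eq _ _ da (d := t - t0)
    (x := upper_fun t0 r k m); rewrite ?subr_gt0 //.
  rewrite upper_funE (max_idPr _) //.
  by move: ut; rewrite ltr_norml => /andP[]; lra.
by rewrite e dv.
Qed.

Lemma ae_gt : {ae mu, forall t, I_zero t0 L t -> t0 < t}.
Proof.
exists [set t0]; split; [exact: measurable_set1|exact: lebesgue_measure_set1|].
move=> t /= h; apply: contrapT => nt; apply: h.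
rewrite /I_zero /= in_itv /= => /andP[h _]; rewrite lt_neqAle h andbT.
by apply/eqP => E; apply: nt; rewrite E.
Qed.

Variables (f : R -> R) (m mbar : R).
Hypotheses (cf : continuous f) (m0 : 0 < m) (mbar0 : 0 < mbar).
Hypothesis f_lower : forall y, lo - m * L <= y -> - m <= f y.
Hypothesis f_upper : forall y, y <= hi + mbar * L -> f y <= mbar.
Local Notation alpha := (lower_fun t0 r k m).
Local Notation beta := (upper_fun t0 r k mbar).

Variable tau : R -> (R -> R) -> R.
Hypothesis car : caratheodory t0 L r tau.

Lemma tau_bounds t : I_zero t0 L t ->
  [/\ I_all t0 L r (tau_inf t0 L r tau t), I_all t0 L r (tau_sup t0 L r tau t) &
      tau_inf t0 L r tau t <= tau_sup t0 L r tau t].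
Proof.
move=> It; pose A := [set tau t g | g in contC (I_all t0 L r)].
have c0 : contC (I_all t0 L r) (fun=> 0 : R).
  by apply/within_continuousP => s _ e e0; exists 1 => // u _ _; rewrite subrr normr0.
have A0 : A (tau t (fun=> 0)) by exists (fun=> 0).
have AI u : A u -> t0 - r <= u <= t0 + L.
  by move=> [g cg <-]; apply/I_allE; exact: (car_range car).
have lbA : has_lbound A by exists (t0 - r) => u /AI /andP[].
have ubA : has_ubound A by exists (t0 + L) => u /AI /andP[].
have h1 : inf A <= tau t (fun=> 0) by exact: ge_inf.
have h2 : tau t (fun=> 0) <= sup A by exact: ub_le_sup.
have h3 : t0 - r <= inf A by apply: lb_le_inf; [exists (tau t (fun=> 0))|move=> u /AI /andP[]].
have h4 : sup A <= t0 + L by apply: ge_sup; [exists (tau t (fun=> 0))|move=> u /AI /andP[]].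
have /andP[h5 h6] := AI _ A0.
rewrite /tau_inf /tau_sup -/A; split; last exact: le_trans h1 h2.
- by apply/I_allE; rewrite h3 (le_trans h1 h6).
- by apply/I_allE; rewrite h4 (le_trans h5 h2).
Qed.

(** Bounds that do not depend on [tau]: they hold for the values of the envelopes
    on the whole interval. *)
Lemma E_set_bounds t : I_zero t0 L t -> exists u v : R,
  [/\ E_set t0 L r tau alpha beta t = `[u, v]%classic, u <= v,
      lo - m * L <= u & v <= hi + mbar * L].
Proof.
move=> /tau_bounds[]; set p := tau_inf _ _ _ _ _; set q := tau_sup _ _ _ _ _.
move=> Ip Iq pq.
have JI s : `[p, q]%classic s -> I_all t0 L r s.
  rewrite /= in_itv /= => /andP[ps sq]; apply/I_allE.
  move: Ip Iq => /I_allE/andP[h _] /I_allE/andP[_ h'].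
  by rewrite (le_trans h ps) (le_trans sq h').
have [u [uJ Eu hu]] := set_min_image pq (lipschitz_contC m0 (lower_lipschitz m0)).
have [v [vJ Ev hv]] := set_max_image pq (lipschitz_contC mbar0 (upper_lipschitz mbar0)).
exists (alpha u), (beta v); split.
- by rewrite /E_set -/p -/q Eu Ev.
- apply: le_trans (lower_le_upper m0 mbar0 (JI _ uJ)) _; exact: hv.
- exact/lower_ge/JI.
- exact/upper_le/JI.
Qed.

Lemma lower_upper_solution_envelopes :
  lower_upper_solution t0 L r k f tau alpha beta.
Proof.
split.
- exact/(lipschitz_contC m0)/lower_lipschitz.
- exact/(lipschitz_contC mbar0)/upper_lipschitz.
- by move=> t; exact: lower_le_upper.
- exact/(lipschitz_abs_cont m0)/lower_lipschitz.
- exact/(lipschitz_abs_cont mbar0)/upper_lipschitz.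
- apply: lebesgue_aeS ae_gt => t ht It.
  have [da ->] := lower_derivable m (ht It); split=> //.
  have [u [v [-> uv hu _]]] := E_set_bounds It.
  have [c [+ -> _]] := set_min_image uv (continuous_subspaceT cf).
  rewrite /= in_itv /= => /andP[uc _].
  exact/f_lower/(le_trans hu).
- move=> t It; rewrite lower_funE (max_idPl _) ?mulr0 ?subr0.
    exact: set_min_init_le.
  by move: It; rewrite /I_minus /= in_itv /= subr_le0 => /andP[].
- apply: lebesgue_aeS ae_gt => t ht It.
  have [da ->] := upper_derivable mbar (ht It); split=> //.
  have [u [v [-> uv _ hv]]] := E_set_bounds It.
  have [c [+ -> _]] := set_max_image uv (continuous_subspaceT cf).
  rewrite /= in_itv /= => /andP[_ cv].
  exact/f_upper/(le_trans cv).
- move=> t It; rewrite upper_funE (max_idPl _) ?mulr0 ?addr0.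
    exact: set_max_init_ge.
  by move: It; rewrite /I_minus /= in_itv /= subr_le0 => /andP[].
Qed.

End Envelopes.

(** * The integral operator of the problem *)

Lemma unif_top_continuous_seq (R : realType) (J : set R)
    (S : set {uniform` J -> R}) (phi : (R -> R) -> R) (y_ : nat -> R -> R) y :
  @unif_top_continuous R J S phi -> (forall j, S (y_ j)) -> S y ->
  (forall j s, J s -> `|y_ j s - y s| <= j.+1%:R^-1) ->
  phi (y_ j) @[j --> \oo] --> phi y.
Proof.
rewrite /unif_top_continuous subspace_continuousP => cphi Sy_ Sy hy.
apply/cvgrPdist_lt => e e0; have /cvgrPdist_lt/(_ _ e0) := cphi y Sy.
rewrite near_withinE => /uniform_nbhs[E [entE hE]].
move: entE; rewrite -entourage_ballE => -[d /= d0 dE].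
have /cvgr0Pnorm_lt/(_ _ d0) := @cvg_harmonic R; apply: filterS => j.
rewrite /= ger0_norm ?invr_ge0 // => jd.
apply: (hE (y_ j)) => // s Js; apply: dE => /=; rewrite /ball /= distrC.
exact: le_lt_trans (hy _ _ Js) jd.
Qed.

Section Operator.
Variables (R : realType) (t0 L r : R) (k f : R -> R) (m mbar : R).
Hypotheses (L0 : 0 < L) (r0 : 0 <= r) (ck : contC (I_minus t0 r) k).
Hypotheses (cf : continuous f) (m0 : 0 < m) (mbar0 : 0 < mbar).
Local Notation mu := (@lebesgue_measure R).
Local Notation lo := (set_min (k @` I_minus t0 r)).
Local Notation hi := (set_max (k @` I_minus t0 r)).
Hypothesis f_lower : forall y, lo - m * L <= y -> - m <= f y.
Hypothesis f_upper : forall y, y <= hi + mbar * L -> f y <= mbar.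
Local Notation alpha := (lower_fun t0 r k m).
Local Notation beta := (upper_fun t0 r k mbar).
Local Notation I := (I_all t0 L r).
Local Notation Y := (fun_interval I alpha beta).
Local Notation K := (slope_class t0 L k m mbar).
Variable tau : R -> (R -> R) -> R.
Hypothesis car : caratheodory t0 L r tau.

Lemma slope_class_contC y : K y -> contC I y.
Proof.
move=> Ky; apply: withinU_continuous.
- exact: interval_closed.
- exact: interval_closed.
- apply/within_continuousP => t It e e0.
  have [d d0 hd] := (within_continuousP _ _).1 ck t It e e0.
  exists d => // s Is st.
  have le_t0 u : I_minus t0 r u -> u <= t0.
    by rewrite /I_minus /= in_itv /= => /andP[].
  by rewrite (sc_init Ky (le_t0 _ It)) (sc_init Ky (le_t0 _ Is)); apply: hd.
- apply: (@lipschitz_contC _ _ (m + mbar)); first by rewrite addr_gt0.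
  move=> s t; rewrite /I_zero /= !in_itv /= => /andP[hs _] /andP[ht _].
  exact: sc_lipschitz Ky hs ht.
Qed.

Lemma slope_class_sub_interval y : K y -> Y y.
Proof.
move=> Ky; have I0 := init_t0 t0 r0.
have klo := set_min_init_le r0 ck; have khi := set_max_init_ge r0 ck.
split; first exact: slope_class_contC.
- move=> t It; rewrite lower_funE; have [tt0|/ltW tt0] := leP t t0.
    rewrite (sc_init Ky tt0) (max_idPl _) ?subr_le0 // mulr0 subr0; apply: klo.
    by move: It => /(I_allE _ L0 r0) /andP[h _]; rewrite /I_minus /= in_itv /= h.
  rewrite (max_idPr _) ?subr_ge0 //.
  have := sc_lower Ky (lexx _) tt0; rewrite (sc_init Ky (lexx t0)).
  by have := klo _ I0; lra.
- move=> t It; rewrite upper_funE; have [tt0|/ltW tt0] := leP t t0.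
    rewrite (sc_init Ky tt0) (max_idPl _) ?subr_le0 // mulr0 addr0; apply: khi.
    by move: It => /(I_allE _ L0 r0) /andP[h _]; rewrite /I_minus /= in_itv /= h.
  rewrite (max_idPr _) ?subr_ge0 //.
  have := sc_upper Ky (lexx _) tt0; rewrite (sc_init Ky (lexx t0)).
  by have := khi _ I0; lra.
Qed.

Definition rhs (y : R -> R) (s : R) : R := f (y (tau s y)).

Lemma rhs_bounds y s : Y y -> I_zero t0 L s -> - m <= rhs y s <= mbar.
Proof.
move=> [cy hlo hhi] Is; have It := car_range car Is cy.
apply/andP; split.
- exact/f_lower/(le_trans _ (hlo _ It))/lower_ge.
- exact/f_upper/(le_trans (hhi _ It))/upper_le.
Qed.

Lemma measurable_I : measurable I.
Proof. by apply: measurableU; exact: measurable_itv. Qed.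

(** A Borel representative of the right-hand side.  As [tau] is only Lebesgue
    measurable in time, so is [rhs y], whereas integrals are taken of Borel
    functions.  Vanishing to the right of [t0 + L] makes the primitive constant
    there. *)
Lemma exists_borel_rhs : exists F : (R -> R) -> R -> R, forall y, Y y ->
  [/\ measurable_fun setT (F y), forall s, - m <= F y s <= mbar,
      forall s, t0 + L < s -> F y s = 0 &
      {ae mu, forall s, I_zero t0 L s -> F y s = rhs y s}].
Proof.
suff /choice[F hF] : forall y, exists Fy : R -> R, Y y ->
  [/\ measurable_fun setT Fy, forall s, - m <= Fy s <= mbar,
      forall s, t0 + L < s -> Fy s = 0 &
      {ae mu, forall s, I_zero t0 L s -> Fy s = rhs y s}] by exists F.
move=> y; have [Yy|nYy] := pselect (Y y); last first.
  by exists (fun=> 0) => /nYy.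
have [cy _ _] := Yy.
have mI0 : measurable (I_zero t0 L) by exact: measurable_itv.
have [N [mN N0 mtau]] := lebesgue_measurable_borel_off_null mI0 (car_meas car cy).
pose D := I_zero t0 L `\` N.
have mD : measurable D by exact: measurableD.
have mr : measurable_fun D (rhs y).
  have -> : rhs y = (f \o y) \o (tau ^~ y) by [].
  apply: (@measurable_comp _ _ _ _ _ _ I) => //.
  - exact: measurable_I.
  - by move=> _ [s [Is _] <-]; exact: (car_range car).
  - apply: measurableT_comp; first exact: continuous_measurable_fun.
    by apply: subspace_continuous_measurable_fun => //; exact: measurable_I.
exists (rhs y \_ D) => _.
have z0 s : ~ D s -> (rhs y \_ D) s = 0 by move=> nD; rewrite patchE memNset.
have z1 s : D s -> (rhs y \_ D) s = rhs y s by move=> Ds; rewrite patchE mem_set.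
split.
- by apply/(measurable_restrictT (rhs y) mD); exact: mr.
- move=> s; have [Ds|nD] := pselect (D s).
    by rewrite z1 //; apply: rhs_bounds => //; case: Ds.
  by rewrite z0 // oppr_le0 !ltW.
- move=> s hs; apply: z0 => -[]; rewrite /I_zero /= in_itv /= => /andP[_].
  by rewrite leNgt hs.
- exists N; split=> // s /= h; apply: contrapT => nN; apply: h => Is.
  exact: z1.
Qed.

Section WithRepresentative.
Variable F : (R -> R) -> R -> R.
Hypothesis hF : forall y, Y y ->
  [/\ measurable_fun setT (F y), forall s, - m <= F y s <= mbar,
      forall s, t0 + L < s -> F y s = 0 &
      {ae mu, forall s, I_zero t0 L s -> F y s = rhs y s}].

Definition picard (y : R -> R) (t : R) : R :=
  if t <= t0 then k t else k t0 + primitive (F y) t0 t.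

Lemma picardE y t : t0 <= t -> picard y t = k t0 + primitive (F y) t0 t.
Proof.
rewrite le_eqVlt /picard => /orP[/eqP <-|]; last by rewrite ltNge => /negbTE ->.
by rewrite lexx primitive0 addr0.
Qed.

Lemma picard_slope_class y : Y y -> K (picard y).
Proof.
move=> Yy; have [mF Fb F0 _] := hF Yy.
have ps s t : t0 <= s -> s <= t ->
    - m * (t - s) <= picard y t - picard y s <= mbar * (t - s).
  move=> hs st; rewrite !picardE ?(le_trans hs st) // opprD addrACA subrr add0r.
  exact: primitive_slope.
split=> [t tt0|s t hs st|s t hs st|t tt1].
- by rewrite /picard tt0.
- by case/andP: (ps _ _ hs st).
- by case/andP: (ps _ _ hs st).
- have t01 : t0 <= t0 + L by rewrite lerDl ltW.
  rewrite !picardE ?(le_trans t01 tt1) //; congr (_ + _).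
  exact: (primitive_final mF Fb).
Qed.

Lemma rhs_cvg (y_ : nat -> R -> R) y : (forall j, Y (y_ j)) -> Y y ->
  (forall j t, I t -> `|y_ j t - y t| <= j.+1%:R^-1) ->
  {ae mu, forall s, I_zero t0 L s -> rhs (y_ j) s @[j --> \oo] --> rhs y s}.
Proof.
move=> Yy_ Yy hy; apply: lebesgue_aeS (car_cont car) => s ctau Is.
have [cy _ _] := Yy.
have cy_ j : contC I (y_ j) by have [] := Yy_ j.
have ht : tau s (y_ j) @[j --> \oo] --> tau s y.
  exact: (unif_top_continuous_seq (ctau Is)).
have hyt : y_ j (tau s (y_ j)) @[j --> \oo] --> y (tau s y).
  apply/cvgrPdist_lt => e e0; have e2 : 0 < e / 2 by rewrite divr_gt0.
  have Ity := car_range car Is cy.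
  have [d d0 hd] := (within_continuousP _ _).1 cy _ Ity _ e2.
  have /cvgrPdist_lt/(_ _ d0) := ht.
  have /cvgr0Pnorm_lt/(_ _ e2) := @cvg_harmonic R.
  apply: filterS2 => j; rewrite /= ger0_norm ?invr_ge0 // => h1 h2.
  have It := car_range car Is (cy_ j).
  have h3 : `|y (tau s (y_ j)) - y (tau s y)| < e / 2.
    by apply: hd => //; rewrite distrC.
  have h4 := le_lt_trans (hy j _ It) h1.
  rewrite distrC (splitr e) (_ : _ - _ = (y_ j (tau s (y_ j)) - y (tau s (y_ j)))
    + (y (tau s (y_ j)) - y (tau s y))); last by ring.
  exact: le_lt_trans (ler_normD _ _) (ltrD h4 h3).
by apply: (cvg_comp (fun j => y_ j (tau s (y_ j))) f hyt); exact: cf.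
Qed.

Lemma picard_cvg (y_ : nat -> R -> R) y : (forall j, Y (y_ j)) -> Y y ->
  {ae mu, forall s, I_zero t0 L s -> rhs (y_ j) s @[j --> \oo] --> rhs y s} ->
  forall t, picard (y_ j) t @[j --> \oo] --> picard y t.
Proof.
move=> Yy_ Yy hr t; rewrite /picard; case: leP => tt0; first exact: cvg_cst.
apply: cvgD; first exact: cvg_cst.
have [mF Fb F0 Fr] := hF Yy.
apply: (@primitive_cvg _ _ _ m mbar) => //.
- by move=> j; have [] := hF (Yy_ j).
- by move=> j; have [] := hF (Yy_ j).
have all_j : {ae mu, forall s, forall j, I_zero t0 L s -> F (y_ j) s = rhs (y_ j) s}.
  apply/ae_foralln => j; by have [] := hF (Yy_ j).
apply: lebesgue_aeS (lebesgue_aeI (lebesgue_aeI all_j Fr) hr).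
move=> s [[h1 h2] h3] ts.
have [sL|Ls] := leP s (t0 + L).
  have Is : I_zero t0 L s.
    move: ts; rewrite /I_zero /= !in_itv /= => /andP[-> _]; exact: sL.
  rewrite h2 //; apply: cvg_trans (h3 Is); apply: near_eq_cvg.
  by apply: nearW => j; rewrite h1.
rewrite F0 //; apply: cvg_near_cst; apply: nearW => j.
by have [_ _ -> //] := hF (Yy_ j); rewrite eqxx.
Qed.

(** The continuity of the operator applied to a constant sequence. *)
Lemma picard_ext y z : Y y -> Y z -> eq_on I y z -> picard y = picard z.
Proof.
move=> Yy Yz yz; apply/funext => t.
have h : picard ((fun=> y) (j : nat)) t @[j --> \oo] --> picard z t.
  apply: picard_cvg => //; apply: aeW => s Is.
  have [[cy _ _] [cz _ _]] := (Yy, Yz).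
  have -> : rhs z s = rhs y s; last exact: cvg_cst.
  rewrite /rhs (car_ext car Is cz cy) => [|u Iu]; last by rewrite yz.
  by rewrite yz //; exact: (car_range car).
exact: (cvg_unique _ (cvg_cst _) h).
Qed.

Lemma picard_seq_continuous : seq_continuous t0 L k m mbar picard.
Proof.
move=> y_ y Ky_ Ky hy; have Yy_ j := slope_class_sub_interval (Ky_ j).
have Yy := slope_class_sub_interval Ky.
by apply: picard_cvg => //; apply: rhs_cvg.
Qed.

Lemma picard_abs_cont y : Y y -> abs_cont_on (I_zero t0 L) (picard y).
Proof.
move=> /picard_slope_class Kp; apply: (@lipschitz_abs_cont _ _ (m + mbar)).
  by rewrite addr_gt0.
move=> s t; rewrite /I_zero /= !in_itv /= => /andP[hs _] /andP[ht _].
exact: sc_lipschitz Kp hs ht.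
Qed.

Lemma picard_derivable y : Y y -> {ae mu, forall t, I_zero t0 L t ->
  derivable (picard y) t 1 /\ derive1 (picard y) t = rhs y t}.
Proof.
move=> Yy; have [mF Fb F0 Fr] := hF Yy.
apply: lebesgue_aeS
  (lebesgue_aeI (lebesgue_aeI (primitive_derivable mF Fb t0) Fr) (ae_gt t0 L)).
move=> t [[h1 h2] h3] It; have tt0 := h3 It; have [dp ep] := h1 tt0.
have [d1 e1] := derive1_sub dp (derivable_cst (- k t0) t 1).
have [|u ut|d e] := derivable_local_eq (x := picard y) _ _ d1 (d := t - t0).
- by rewrite subr_gt0.
- rewrite picardE; first by rewrite /= opprK addrC.
  by move: ut; rewrite ltr_norml => /andP[]; lra.
- by split=> //; rewrite e e1 derive1_cst subr0 ep h2.
Qed.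

Lemma picard_fixpoint_solution y : K y -> picard y = y ->
  solution t0 L r k f tau y.
Proof.
move=> Ky Ty; have Yy := slope_class_sub_interval Ky.
split.
- exact: slope_class_contC.
- by rewrite -Ty; exact: picard_abs_cont.
- by have := picard_derivable Yy; rewrite Ty.
- by move=> t; rewrite /I_minus /= in_itv /= => /andP[_ /(sc_init Ky)].
Qed.

(** A solution and its Picard iterate have the same derivative almost everywhere
    and the same value at [t0]. *)
Lemma solution_picard x : Y x -> solution t0 L r k f tau x ->
  eq_on I x (picard x).
Proof.
move=> Yx [cx ax dx ix] t [It|It].
  rewrite ix // /picard; move: It; rewrite /I_minus /= in_itv /= => /andP[_ ->].
  by [].
pose D u := x u - picard x u.
move: (It); rewrite /I_zero /= in_itv /= => /andP[tt0 tt1].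
have sub u : `[t0, t]%classic u -> I_zero t0 L u.
  by rewrite /I_zero /= !in_itv /= => /andP[-> h]; rewrite (le_trans h tt1).
have : D t = D t0.
  apply: abs_cont_zero_derivative => //.
    have aD := abs_contB ax (picard_abs_cont Yx).
    move=> e /aD[d d0 hd]; exists d => // n a b hab.
    by apply: hd => i; have [h1 h2 h3] := hab i; split=> //; exact: sub.
  apply: lebesgue_aeS (lebesgue_aeI dx (picard_derivable Yx)) => u [h1 h2] /sub Iu.
  have [dxu exu] := h1 Iu; have [dpu epu] := h2 Iu.
  have [dD eD] := derive1_sub dxu dpu.
  by split=> //; rewrite eD exu epu subrr.
rewrite /D {2}/picard lexx (ix _ (init_t0 t0 r0)).
by rewrite subrr => /eqP; rewrite subr_eq0 => /eqP.
Qed.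

(** A solution is determined on [I] only; its Picard iterate is the
    representative that is a fixed point on the whole line. *)
Lemma solution_to_fixpoint x : Y x -> solution t0 L r k f tau x ->
  exists z, [/\ K z, picard z = z & eq_on I x z].
Proof.
move=> Yx sx; have xz := solution_picard Yx sx.
have Kz := picard_slope_class Yx.
exists (picard x); split=> //; apply/esym/picard_ext => //.
exact: slope_class_sub_interval.
Qed.

Lemma picard_stable y : K y -> K (picard y).
Proof. by move=> /slope_class_sub_interval/picard_slope_class. Qed.

Lemma exists_maximal_solution :
  exists xM, maximal_solution t0 L r k f tau Y xM.
Proof.
have [||x y h|z [Kz Tz zmax]] := exists_premaximal_fixpoint L0 m0 mbar0
  picard_stable picard_seq_continuous (le := le_on I).
- by move=> x t _.
- by move=> y x z xy yz t It; exact: le_trans (xy _ It) (yz _ It).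
- move=> t It; apply/ler_addgt0Pl => e /h[u [/(_ _ It) xu /(_ t)]].
  by rewrite ler_norml => /andP[_]; lra.
exists z; split.
- exact: slope_class_sub_interval.
- exact: picard_fixpoint_solution.
move=> x Yx /(solution_to_fixpoint Yx)[u [Ku Tu xu]] zx t It.
apply/eqP; rewrite eq_le zx // andbT xu //; apply: zmax => // s Is.
by rewrite -xu // zx.
Qed.

Lemma exists_minimal_solution :
  exists xm, minimal_solution t0 L r k f tau Y xm.
Proof.
have [||x y h|z [Kz Tz zmin]] := exists_premaximal_fixpoint L0 m0 mbar0
  picard_stable picard_seq_continuous (le := fun x y => le_on I y x).
- by move=> x t _.
- by move=> y x z xy yz t It; exact: le_trans (yz _ It) (xy _ It).
- move=> t It; apply/ler_addgt0Pl => e /h[u [/(_ _ It) xu /(_ t)]].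
  by rewrite ler_norml => /andP[]; lra.
exists z; split.
- exact: slope_class_sub_interval.
- exact: picard_fixpoint_solution.
move=> x Yx /(solution_to_fixpoint Yx)[u [Ku Tu xu]] xz t It.
apply/eqP; rewrite eq_le xz //= xu //; apply: zmin => // s Is.
by rewrite -xu // xz.
Qed.

End WithRepresentative.

Lemma exists_extremal_solutions :
  (exists xM, maximal_solution t0 L r k f tau Y xM) /\
  (exists xm, minimal_solution t0 L r k f tau Y xm).
Proof.
have [F hF] := exists_borel_rhs.
by split; [exact: exists_maximal_solution hF|exact: exists_minimal_solution hF].
Qed.

End Operator.

(** * The constants [m] and [mbar] *)

Section Growth.
Variables (R : realType) (L : R) (f : R -> R).
Hypotheses (L0 : 0 < L) (cf : continuous f).

Lemma slope_between (c : R) : c < 1 / L ->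
  exists c', [/\ 0 <= c', c' < 1 / L & c < c'].
Proof.
move=> cL; have iL : 0 < 1 / L by rewrite divr_gt0.
exists ((Num.max 0 c + 1 / L) / 2).
have h1 : 0 <= Num.max 0 c by rewrite le_max lexx.
have h2 : c <= Num.max 0 c by rewrite le_max lexx orbT.
have h3 : Num.max 0 c < 1 / L by rewrite gt_max iL cL.
by split; lra.
Qed.

Lemma upper_growth_bound (v c : R) : f y @[y --> -oo] --> -oo ->
  f y / y @[y --> +oo] --> c -> c < 1 / L ->
  exists2 m, 0 < m & forall y, y <= v + m * L -> f y <= m.
Proof.
move=> fNy fy /slope_between[c' [c'0 c'L cc']].
have [A [_ hA]] := (cvgrNyPle _).1 fNy 0.
have e0 : 0 < c' - c by rewrite subr_gt0.
have /cvgrPdist_lt/(_ _ e0)[B [_ hB]] := fy.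
apply: (@sublinear_bound _ L v f c' A (Num.max B 0)) => // y.
rewrite gt_max => /andP[/hB /= + y0]; rewrite ltr_norml => /andP[h _].
by rewrite -ler_pdivrMr //; lra.
Qed.

End Growth.

(** The reflection [y |-> - f (- y)] exchanges the two ends of the line. *)
Lemma lower_growth_bound (R : realType) (L : R) (f : R -> R) (v c : R) :
  0 < L -> continuous f -> f y @[y --> +oo] --> +oo ->
  f y / y @[y --> -oo] --> c -> c < 1 / L ->
  exists2 m, 0 < m & forall y, v - m * L <= y -> - m <= f y.
Proof.
move=> L0 cf fy fNy /(slope_between L0)[c' [c'0 c'L cc']].
have [A [_ hA]] := (cvgryPge _).1 fy 0.
have e0 : 0 < c' - c by rewrite subr_gt0.
have /cvgrPdist_lt/(_ _ e0)[B [_ hB]] := fNy.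
have [|y yA|y yB|m m0 hm] := @sublinear_bound _ L (- v) (fun y => - f (- y))
  c' (- A) (Num.max (- B) 0) L0 _ c'0 c'L.
- move=> y; apply: cvgN; apply: (@continuous_comp _ _ _ -%R f); last exact: cf.
  exact: opp_continuous.
- by rewrite oppr_le0; apply: hA; rewrite ltrNr.
- move: yB; rewrite gt_max => /andP[yB y0].
  have /hB /= : - y < B by rewrite ltrNl.
  rewrite ltr_norml invrN mulrN -mulNr => /andP[h _].
  by rewrite -ler_pdivrMr //; lra.
exists m => // y hy; have := hm (- y); rewrite opprK => h.
by rewrite lerNl; apply: h; lra.
Qed.

Unset Implicit Arguments.

Theorem proposition3p1 (R : realType) (t0 L r : R) (hL : 0 < L) (hr : 0 <= r)
    (k : R -> R) (hk : contC (I_minus t0 r) k)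
    (f : R -> R) (hf : continuous f)
    (hf_pinfty : f y @[y --> +oo] --> +oo)
    (hf_ninfty : f y @[y --> -oo] --> -oo)
    (cp cm : R)
    (hcp : f y / y @[y --> +oo] --> cp) (hcpL : cp < 1 / L)
    (hcm : f y / y @[y --> -oo] --> cm) (hcmL : cm < 1 / L) :
  exists m mbar : R, [/\ 0 < m, 0 < mbar &
    forall tau : R -> (R -> R) -> R, caratheodory t0 L r tau ->
      let alpha := lower_fun t0 r k m in
      let beta := upper_fun t0 r k mbar in
      let Y := fun_interval (I_all t0 L r) alpha beta in
      [/\ lower_upper_solution t0 L r k f tau alpha beta,
          exists xM, maximal_solution t0 L r k f tau Y xM &
          exists xm, minimal_solution t0 L r k f tau Y xm]].
Proof.
have [m m0 hm] := lower_growth_bound (set_min (k @` I_minus t0 r)) hL hf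
  hf_pinfty hcm hcmL.
have [mbar mbar0 hmbar] := upper_growth_bound hL hf (set_max (k @` I_minus t0 r))
  hf_ninfty hcp hcpL.
exists m, mbar; split=> // tau car alpha beta Y.
have [hM hMin] := exists_extremal_solutions hL hr hk hf m0 mbar0 hm hmbar car.
by split=> //; exact: lower_upper_solution_envelopes.
Qed.
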